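(* Let $X$ be a compact space. The class of maps $X\to\mathcal F(H)$ that are continuous in the $F$-topology is strictly wider than the class of maps $A:X\to\mathcal F(H)$, continuous in the strong operator topology, for which there is a map $B:X\to\mathcal F(H)$, continuous in the strong operator topology, such that for every $x\in X$ the operators $A(x)B(x)-I$ and $B(x)A(x)-I$ are compact, and the maps $AB-I,\ BA-I:X\to\mathcal K(H)$ are continuous in the uniform (operator norm) topology.
   Context: $H$ is a separable infinite-dimensional complex Hilbert space, $\mathcal F(H)$ the set of bounded Fredholm operators on $H$, $\mathcal K(H)$ the compact operators on $H$, $GL(H)$ the invertible bounded operators on $H$, and $I$ the identity operator. Products of operator-valued maps are pointwise: $(AB-I)(x)=A(x)B(x)-I$. The $F$-topology on $\mathcal F(H)$ is the topology with subbase consisting of all sets $$U_{\varepsilon,a_1,\dots,a_n,A}=\{B\in\mathcal F(H):\|(B-A)a_i\|<\varepsilon\ \ \forall i=1,\dots,n\},$$ $$U_{\varepsilon,V,A}=\{B\in\mathcal F(H):\exists R\in GL(H),\ R(V)\subset V,\text{ such that }\|RB-A\|<\varepsilon\},$$ where $\varepsilon>0$, $A\in\mathcal F(H)$, $a_1,\dots,a_n\in H$, and $V\subset H$ is a finite-dimensional subspace.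
   Formalization: The inclusion is stated for every compact X, but strictness only for X infinite and Hausdorff; for a finite discrete X (e.g. a point), or an indiscrete X, the two classes coincide, so ''strictly wider'' fails there. *)

(* Defs.v *)
From HB Require Import structures.
From mathcomp Require Import all_boot all_order all_algebra.
From mathcomp Require Import complex.
From mathcomp Require Import all_classical all_reals all_analysis.

Set Implicit Arguments.
Unset Strict Implicit.
Unset Printing Implicit Defensive.

Import Order.TTheory GRing.Theory Num.Theory.
Import numFieldNormedType.Exports.

Local Open Scope classical_set_scope.
Local Open Scope complex_scope.
Local Open Scope ring_scope.

Section HilbertSpace.
Context {R : realType} {H : completeNormedModType R[i]}.
Implicit Types (T : H -> H) (V : set H).

(* The inner product [ip] is linear in its first argument and conjugate linear
   in the second; positivity and hermitian symmetry are part of [{dot _ for _}].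
   Completeness of [H] is the completeness for the norm of [ip]. *)
Definition norm_from_dot (ip : {dot H for (@Num.conj R[i])}) :=
  forall x : H, `|x| ^+ 2 = ip x x.

Definition separable := exists2 D : set H, countable D & dense D.

Definition lin_span n (v : 'I_n -> H) : set H :=
  [set x | exists c : 'I_n -> R[i], x = \sum_(i < n) c i *: v i].

(* Finite-dimensional linear subspaces: the linear spans of finite families. *)
Definition fin_dim_subspace V := exists n (v : 'I_n -> H), V = lin_span v.

Definition bounded_op T :=
  linear T /\ exists M : R, forall x, `|T x| <= M%:C * `|x|.

(* Norms of vectors are real elements of [R[i]]. *)
Definition opnorm T : R :=
  sup [set complex.Re `|T x| | x in [set x : H | `|x| <= 1]].

(* Finite-dimensional cokernel: finitely many classes [m i + T(H)] span the
   quotient [H / T(H)]. *)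
Definition fredholm T :=
  [/\ bounded_op T,
      fin_dim_subspace [set x | T x = 0],
      closed (range T) &
      exists n (m : 'I_n -> H),
        forall y, exists x, exists2 z, lin_span m z & y = T x + z].

Definition compact_operator T :=
  bounded_op T /\ precompact (T @` [set x : H | `|x| <= 1]).

Definition invertible_op T :=
  bounded_op T /\
  exists S : H -> H, [/\ bounded_op S, cancel T S & cancel S T].

End HilbertSpace.

Arguments separable {R} H.

Section OperatorSpaces.
Context {R : realType} (H : completeNormedModType R[i]).

Record fredholm_op := FredholmOp {
  fredholm_fun :> H -> H;
  fredholm_opP : fredholm fredholm_fun }.

HB.instance Definition _ := gen_eqMixin fredholm_op.
HB.instance Definition _ := gen_choiceMixin fredholm_op.

Record compact_op := CompactOp {
  compact_fun :> H -> H;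
  compact_opP : compact_operator compact_fun }.

HB.instance Definition _ := gen_eqMixin compact_op.
HB.instance Definition _ := gen_choiceMixin compact_op.

(* Strong operator topology: pointwise convergence in the norm of [H]. *)
Definition fredholm_strong : Type :=
  initial_topology (fredholm_fun : fredholm_op -> {ptws H -> H}).
HB.instance Definition _ := Topological.on fredholm_strong.

Definition F_nbhd_pt (eps : R) n (a : 'I_n -> H) (A : fredholm_op) :
    set fredholm_op :=
  [set B : fredholm_op | forall i, `|B (a i) - A (a i)| < eps%:C].

Definition F_nbhd_subspace (eps : R) (V : set H) (A : fredholm_op) :
    set fredholm_op :=
  [set B : fredholm_op | exists T : H -> H,
     [/\ invertible_op T, T @` V `<=` V & opnorm ((T \o B) \- A) < eps]].

Definition F_subbase : set (set fredholm_op) :=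
  [set U | exists eps A n (a : 'I_n -> H), 0 < eps /\ U = F_nbhd_pt eps a A]
  `|`
  [set U | exists eps A V,
     [/\ 0 < eps, fin_dim_subspace V & U = F_nbhd_subspace eps V A]].

Definition fredholm_F : Type := fredholm_op.
HB.instance Definition _ := Choice.on fredholm_F.
HB.instance Definition _ :=
  isSubBaseTopological.Build fredholm_F F_subbase id.

Definition norm_balls : set (set compact_op) :=
  [set U | exists (eps : R) (K : compact_op),
     0 < eps /\ U = [set L : compact_op | opnorm (L \- K) < eps]].

(* [K(H)] with the uniform topology, generated by the open operator-norm
   balls. *)
Definition compact_uniform : Type := compact_op.
HB.instance Definition _ := Choice.on compact_uniform.
HB.instance Definition _ :=
  isSubBaseTopological.Build compact_uniform norm_balls id.

End OperatorSpaces.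

Section MapClasses.
Context {R : realType} (H : completeNormedModType R[i]) (X : topologicalType).

Definition strongly_continuous (A : X -> fredholm_op H) :=
  continuous (A : X -> fredholm_strong H).

Definition F_continuous_maps : set (X -> fredholm_op H) :=
  [set A : X -> fredholm_op H | continuous (A : X -> fredholm_F H)].

(* [K] and [L] are the maps [AB - I] and [BA - I]; their type records that
   their values are compact operators. *)
Definition parametrix_maps : set (X -> fredholm_op H) :=
  [set A | strongly_continuous A /\
     exists B : X -> fredholm_op H, strongly_continuous B /\
     exists K L : X -> compact_uniform H,
       [/\ forall x, compact_fun (K x) = (A x \o B x) \- id,
           forall x, compact_fun (L x) = (B x \o A x) \- id,
           continuous K & continuous L]].

End MapClasses.

Arguments F_subbase {R} H.
Arguments F_continuous_maps {R} H X.
Arguments parametrix_maps {R} H X.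

(* Main.v *)
(* Given a parametrix B of A, the uniform boundedness principle on the compact
   space X bounds both families in norm. Let C be a generalized inverse of
   A(x0), so that A(x0) C = 1 - Q and C A(x0) = 1 - P with P, Q of finite rank
   and A(x0) P = 0. Then T(x) = A(x) C + Q converges strongly to 1 and
   T(x) A(x0) - A(x) = - A(x) P tends to 0 in norm, since strong convergence
   becomes norm convergence after composition with a finite rank operator. The
   norm continuity of AB - I and BA - I makes T(x) invertible with uniformly
   bounded inverse near x0, and a small finite rank correction makes T(x) fix a
   prescribed finite-dimensional V pointwise; hence T(x)^-1 A(x) -> A(x0) in
   norm, which is convergence for the subbasic sets U_{eps,V,A}.

   For strictness take an orthonormal sequence e, bumps u_n on X with disjoint
   supports and u_n(x_n) = 1, h(x) = e_0 + sum_n u_n(x) e_{n+1} and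
   A(x) v = v - <v, h(x)> e_0. Since h is weakly continuous, A is F-continuous
   by the same criterion, the operators T(x) v = v - <v, h(x) - h(x0)> e_0 being
   explicitly invertible. If K = AB - I, then <K(x_n) e_{n+1}, h(x_n)> = -1
   because the range of A(x) is orthogonal to h(x); but a norm continuous family
   of compact operators on X cannot have this property, as e_n tends weakly
   to 0. *)

Require Import Defs.
From HB Require Import structures.
From mathcomp Require Import all_boot all_order all_algebra.
From mathcomp Require Import complex.
From mathcomp Require Import all_classical all_reals all_analysis.
From mathcomp Require Import ring lra.

Set Implicit Arguments.
Unset Strict Implicit.
Unset Printing Implicit Defensive.

Import Order.TTheory GRing.Theory Num.Theory.
Import numFieldNormedType.Exports.

Local Open Scope classical_set_scope.
Local Open Scope complex_scope.
Local Open Scope ring_scope.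

(** * Linear identities in abelian groups by reflection *)

Inductive zexp := ZVar of nat | ZAdd of zexp & zexp | ZOpp of zexp | ZZero.

Fixpoint zeval (V : zmodType) (env : seq V) (e : zexp) : V :=
  match e with
  | ZVar i => env`_i
  | ZAdd a b => zeval env a + zeval env b
  | ZOpp a => - zeval env a
  | ZZero => 0
  end.

Fixpoint zcoef (e : zexp) (i : nat) : int :=
  match e with
  | ZVar j => if j == i then 1 else 0
  | ZAdd a b => zcoef a i + zcoef b i
  | ZOpp a => - zcoef a i
  | ZZero => 0
  end.

Lemma zeval_coef (V : zmodType) (env : seq V) e :
  zeval env e = \sum_(i < size env) env`_i *~ zcoef e i.
Proof.
elim: e => [j|a IHa b IHb|a IHa|] /=.
- have [jlt|jge] := ltnP j (size env); last first.
    rewrite nth_default// big1// => i _.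
    by case: eqP => [ji|_]; rewrite ?mulr0z// ji leqNgt ltn_ord in jge.
  rewrite (bigD1 (Ordinal jlt))//= eqxx mulr1z big1 ?addr0// => i.
  by rewrite eq_sym -val_eqE /= => /negbTE ->; rewrite mulr0z.
- by rewrite IHa IHb -big_split; apply: eq_bigr => i _; rewrite mulrzDr.
- by rewrite IHa -sumrN; apply: eq_bigr => i _; rewrite mulrNz.
- by rewrite big1// => i _; rewrite mulr0z.
Qed.

(** Only the integer coefficient of each variable matters, and comparing coefficients is a boolean
    computation. *)
Lemma zeval_eq (V : zmodType) (env : seq V) a b :
  all (fun i => zcoef a i == zcoef b i) (iota 0 (size env)) ->
  zeval env a = zeval env b.
Proof.
move=> /allP ab; rewrite !zeval_coef; apply: eq_bigr => i _.
by rewrite (eqP (ab _ _))// mem_iota add0n ltn_ord.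
Qed.

(** Atoms are compared by unification; the inner [match] runs [unify] inside a term-producing
    tactic, and its failure selects the next branch. *)
Ltac zindex x env :=
  lazymatch env with
  | (?y :: ?env') =>
    match constr:(tt) with
    | _ => let _ := match constr:(tt) with _ => unify x y end in constr:(0%N)
    | _ => let n := zindex x env' in constr:(S n)
    end
  end.

Ltac zadd x env :=
  match constr:(tt) with
  | _ => let _ := zindex x env in env
  | _ => constr:(x :: env)
  end.

Ltac zvars e env :=
  lazymatch e with
  | (?a + ?b)%R => let env := zvars a env in zvars b env
  | (- ?a)%R => zvars a env
  | 0%R => env
  | _ => zadd e env
  end.

Ltac zreify e env :=
  lazymatch e with
  | (?a + ?b)%R =>
    let a := zreify a env in let b := zreify b env in constr:(ZAdd a b)
  | (- ?a)%R => let a := zreify a env in constr:(ZOpp a)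
  | 0%R => constr:(ZZero)
  | _ => let n := zindex e env in constr:(ZVar n)
  end.

(* Decides equations between integral combinations in an abelian group. *)
Ltac zmod :=
  lazymatch goal with
  | |- @eq ?V ?a ?b =>
    let env := zvars a (@nil V) in
    let env := zvars b env in
    let a' := zreify a env in
    let b' := zreify b env in
    exact: (@zeval_eq _ env a' b' isT)
  end.

(** * Norms and bounded operators *)

Section Norm.
Context {R : realType}.

(* Norms on an [R[i]]-module are [R[i]]-valued; [nr] takes values in [R]. *)
Definition nr {V : normedZmodType R[i]} (v : V) : R := complex.Re `|v|.

Section NormedZmod.
Context {V : normedZmodType R[i]}.
Implicit Types u v w : V.

Lemma normE v : `|v| = (nr v)%:C.
Proof. by rewrite /nr RRe_real// ger0_real. Qed.

Lemma nr_ge0 v : 0 <= nr v.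
Proof. by rewrite -lecR -normE normr_ge0. Qed.

Lemma nr0 : nr (0 : V) = 0.
Proof. by rewrite /nr normr0. Qed.

Lemma nr0_eq0 v : nr v = 0 -> v = 0.
Proof. by move=> v0; apply/normr0_eq0; rewrite normE v0. Qed.

Lemma nr_gt0 v : v != 0 -> 0 < nr v.
Proof.
by move=> v0; rewrite lt0r nr_ge0 andbT; apply: contra v0 => /eqP/nr0_eq0 ->.
Qed.

Lemma nrN v : nr (- v) = nr v.
Proof. by rewrite /nr normrN. Qed.

Lemma nrBC u v : nr (u - v) = nr (v - u).
Proof. by rewrite -nrN opprB. Qed.

Lemma nrD u v : nr (u + v) <= nr u + nr v.
Proof. by rewrite -lecR rmorphD /= -!normE ler_normD. Qed.

Lemma nrB u v : nr (u - v) <= nr u + nr v.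
Proof. by rewrite -(nrN v) nrD. Qed.

Lemma nr_tri u v w : nr (u - w) <= nr (u - v) + nr (v - w).
Proof. by apply: le_trans (nrD _ _); rewrite addrA subrK. Qed.

Lemma nr_lt (e : R) v : (`|v| < e%:C) = (nr v < e).
Proof. by rewrite normE ltcR. Qed.

Lemma nr_eq0_small v : (forall e : R, 0 < e -> nr v <= e) -> v = 0.
Proof.
move=> ve; apply: nr0_eq0; apply/eqP; rewrite eq_le nr_ge0 andbT.
by apply/ler_addgt0Pr => e e0; rewrite add0r ve.
Qed.

End NormedZmod.

Lemma nrM (a b : R[i]) : nr (a * b) = nr a * nr b.
Proof. by apply: complexI; rewrite rmorphM /= -!normE normrM. Qed.

Lemma nrR (a : R) : nr (a%:C : R[i]) = `|a|.
Proof. by apply: complexI; rewrite -normE normc_def /= expr0n addr0 sqrtr_sqr. Qed.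

Lemma nr_conj (a : R[i]) : nr (a^* : R[i])%R = nr a.
Proof. by apply: complexI; rewrite -!normE norm_conjC. Qed.

Context {H : normedModType R[i]}.

Lemma nrZ (a : R[i]) (v : H) : nr (a *: v) = nr a * nr v.
Proof. by apply: complexI; rewrite rmorphM /= -!normE normrZ. Qed.

Lemma nrZR (a : R) (v : H) : nr (a%:C *: v) = `|a| * nr v.
Proof. by rewrite nrZ nrR. Qed.

End Norm.
Section LinearMaps.
Context {K : pzRingType} {U V W : lmodType K}.

Lemma linearE (T : U -> V) : linear T ->
  [/\ T 0 = 0, forall u v, T (u + v) = T u + T v, forall u, T (- u) = - T u,
      forall u v, T (u - v) = T u - T v & forall a u, T (a *: u) = a *: T u].
Proof.
move=> lT; have TD u v : T (u + v) = T u + T v by rewrite -[u]scale1r lT !scale1r.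
have T0 : T 0 = 0 by apply: (addrI (T 0)); rewrite -TD !addr0.
have TZ a u : T (a *: u) = a *: T u by rewrite -[a *: u]addr0 lT T0 addr0.
have TN u : T (- u) = - T u by rewrite -scaleN1r TZ scaleN1r.
by split=> // u v; rewrite TD TN.
Qed.

Lemma lin0 (T : U -> V) : linear T -> T 0 = 0.
Proof. by case/linearE. Qed.

Lemma linD (T : U -> V) : linear T -> forall u v, T (u + v) = T u + T v.
Proof. by case/linearE. Qed.

Lemma linN (T : U -> V) : linear T -> forall u, T (- u) = - T u.
Proof. by case/linearE. Qed.

Lemma linB (T : U -> V) : linear T -> forall u v, T (u - v) = T u - T v.
Proof. by case/linearE. Qed.

Lemma linZ (T : U -> V) : linear T -> forall a u, T (a *: u) = a *: T u.
Proof. by case/linearE. Qed.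

Lemma lin_sum (T : U -> V) n (x : 'I_n -> U) : linear T ->
  T (\sum_(i < n) x i) = \sum_(i < n) T (x i).
Proof.
by move=> lT; apply: (big_morph T); [exact: linD | exact: lin0].
Qed.

Lemma linear_add (S T : U -> V) :
  linear S -> linear T -> linear (fun v => S v + T v).
Proof. by move=> lS lT a u v; rewrite lS lT scalerDr addrACA. Qed.

Lemma linear_sub (S T : U -> V) :
  linear S -> linear T -> linear (fun v => S v - T v).
Proof. by move=> lS lT a u v; rewrite lS lT scalerBr opprD addrACA. Qed.

Lemma linear_comp (S : V -> W) (T : U -> V) :
  linear S -> linear T -> linear (fun v => S (T v)).
Proof. by move=> lS lT a u v; rewrite lT lS. Qed.

End LinearMaps.

(** * Operator bounds, completeness and perturbations of the identity *)

Section Operators.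
Context {R : realType} {H : completeNormedModType R[i]}.
Implicit Types (S T : H -> H) (M e : R).

Definition bounded_by M T := forall v, nr (T v) <= M * nr v.

Lemma bounded_opP T :
  bounded_op T <-> linear T /\ exists2 M, 0 <= M & bounded_by M T.
Proof.
split=> [[lT [M TM]]|[lT [M M0 TM]]]; split=> //.
  exists `|M| => // v.
  have := TM v; rewrite !normE -rmorphM lecR => /le_trans; apply.
  by rewrite ler_wpM2r ?nr_ge0// ler_norm.
by exists M => v; rewrite !normE -rmorphM lecR.
Qed.

Lemma bounded_le M M' T : M <= M' -> bounded_by M T -> bounded_by M' T.
Proof. by move=> MM' TM v; apply: le_trans (TM v) _; rewrite ler_wpM2r ?nr_ge0. Qed.

Lemma bounded_comp M M' S T : 0 <= M -> bounded_by M S -> bounded_by M' T ->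
  bounded_by (M * M') (fun v => S (T v)).
Proof.
move=> M0 SM TM' v; apply: le_trans (SM _) _.
by rewrite -mulrA ler_wpM2l.
Qed.

Lemma bounded_add M M' S T : bounded_by M S -> bounded_by M' T ->
  bounded_by (M + M') (fun v => S v + T v).
Proof.
move=> SM TM v; apply: le_trans (nrD _ _) _.
by rewrite mulrDl lerD.
Qed.

Lemma bounded_sub M M' S T : bounded_by M S -> bounded_by M' T ->
  bounded_by (M + M') (fun v => S v - T v).
Proof.
move=> SM TM v; apply: le_trans (nrB _ _) _.
by rewrite mulrDl lerD.
Qed.

(** Completeness in quantitative form: the Cauchy bound [c n] persists for the distance to the
    limit. *)
Lemma cauchy_limit (u : nat -> H) (c : nat -> R) :
    (forall e, 0 < e -> exists n, c n <= e) ->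
    (forall n m, (n <= m)%N -> nr (u m - u n) <= c n) ->
  exists l, forall n, nr (l - u n) <= c n.
Proof.
move=> c0 uc; have cu : cvg (u @ \oo).
  apply: cauchy_cvg; apply: cauchy_exP => e e0.
  have eE : e = (complex.Re e)%:C by rewrite RRe_real// gtr0_real.
  have e1 : 0 < complex.Re e by rewrite -ltcR -eE.
  have [n cn] := c0 (complex.Re e / 2) ltac:(by rewrite divr_gt0).
  exists (u n), n => // m /= nm.
  rewrite -ball_normE /ball_ /= eE nr_lt nrBC (le_lt_trans (uc _ _ nm))//.
  by apply: le_lt_trans cn _; rewrite ltr_pdivrMr// mulr2n mulrDr mulr1 ltrDl.
exists (lim (u @ \oo)) => n; apply/ler_addgt0Pr => e e0.
have := cu; move/cvgrPdist_lt => /(_ e%:C); rewrite ltcR => /(_ e0) [N _ Nu].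
have /= := Nu (maxn n N) (leq_maxr _ _); rewrite nr_lt => /ltW ue.
apply: le_trans (nr_tri _ (u (maxn n N)) _) _; rewrite addrC.
by apply: lerD ue; exact: uc (leq_maxl _ _).
Qed.

Lemma half_expn_small (c e : R) : 0 < e -> exists n, c * 2^-1 ^+ n <= e.
Proof.
move=> e0; have [n cn] : exists n : nat, `|c| / e <= n%:R.
  by exists (Num.trunc (`|c| / e)).+1; rewrite ltW// truncnS_gt.
exists n; rewrite exprVn ler_pdivrMr ?exprn_gt0//.
rewrite ler_pdivrMr// in cn; apply: le_trans (ler_norm _) (le_trans cn _).
by rewrite mulrC ler_wpM2l ?(ltW e0)// -natrX ler_nat ltnW// ltn_expl.
Qed.

Lemma geometric_limit (u : nat -> H) c : 0 <= c ->
    (forall n, nr (u n.+1 - u n) <= c * 2^-1 ^+ n) ->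
  exists l, forall n, nr (l - u n) <= 2 * c * 2^-1 ^+ n.
Proof.
move=> c0 uc; apply: cauchy_limit => [e e0|n m nm]; first exact: half_expn_small.
(* The exact geometric sum is the form that induction on [m] preserves. *)
suff : nr (u m - u n) <= 2 * c * (2^-1 ^+ n - 2^-1 ^+ m).
  move=> /le_trans; apply; rewrite ler_wpM2l ?mulr_ge0// lerBlDr lerDl.
  by rewrite exprn_ge0// invr_ge0.
elim: m nm => [|m IH]; first by rewrite leqn0 => /eqP ->; rewrite !subrr nr0 mulr0.
rewrite leq_eqVlt ltnS => /predU1P[->|/IH {}IH].
  by rewrite !subrr nr0 mulr0.
apply: le_trans (nr_tri _ (u m) _) _; have := uc m; rewrite exprS; lra.
Qed.

(** Successive approximation: each step adds the residual [y - T (u n)], and the next residual is at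
    most half of it. *)
Lemma neumann_surj T : linear T -> (forall v, nr (T v - v) <= 2^-1 * nr v) ->
  forall y, exists2 x, T x = y & nr x <= 2 * nr y.
Proof.
move=> lT T1 y.
pose u := fix u n := if n is m.+1 then u m + (y - T (u m)) else 0.
have ru n : nr (y - T (u n)) <= nr y * 2^-1 ^+ n.
  elim: n => [|n IH] /=; first by rewrite (lin0 lT) subr0 mulr1.
  rewrite (_ : _ - _ = - (T (y - T (u n)) - (y - T (u n)))); last first.
    by rewrite (linD lT); zmod.
  rewrite nrN exprS; apply: le_trans (T1 _) _; lra.
have [n|l lu] := @geometric_limit u (nr y) (nr_ge0 _).
  by rewrite /= (_ : _ - _ = y - T (u n)) ?ru//; zmod.
have Tl : T l = y.
  apply/eqP; rewrite -subr_eq0; apply/eqP/nr_eq0_small => e e0.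
  have [n ne] := half_expn_small (4 * nr y) e0; apply: le_trans ne.
  have -> : T l - y = (T (l - u n) - (l - u n)) + (l - u n) - (y - T (u n)).
    by rewrite (linB lT); zmod.
  apply: le_trans (nrB _ _) _; apply: le_trans (lerD (nrD _ _) (lexx _)) _.
  have := T1 (l - u n); have := lu n; have := ru n; lra.
by exists l => //; have := lu 0%N; rewrite /= subr0 mulr1.
Qed.

(* The inverse of [T] is [E \o (T \o E)^-1], so its norm is at most [2 * M]. *)
Lemma approx_inverse T (E F : H -> H) M : bounded_op T -> linear E -> linear F ->
    bounded_by M E ->
    (forall v, nr (T (E v) - v) <= 2^-1 * nr v) ->
    (forall v, nr (F (T v) - v) <= 2^-1 * nr v) ->
  exists S, [/\ bounded_op S, cancel T S, cancel S T & bounded_by (2 * M) S].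
Proof.
move=> bT lE lF EM TE FT; have lT := bT.1.
have Tinj v : T v = 0 -> v = 0.
  move=> Tv0; apply: nr0_eq0; have := FT v; rewrite Tv0 (lin0 lF) sub0r nrN.
  have := nr_ge0 v; lra.
have M0 : 0 <= M \/ forall v : H, v = 0.
  have [M0|M0] := leP 0 M; [by left | right=> v].
  apply: nr0_eq0; have := EM v; have := nr_ge0 (E v); have := nr_ge0 v; nra.
have ex y : exists x, T x = y /\ nr x <= 2 * M * nr y.
  have [z Tz zy] := neumann_surj (linear_comp lT lE) TE y.
  exists (E z); split=> //; case: M0 => [M0|all0].
    apply: le_trans (EM z) _; rewrite mulrAC [2 * _ * _]mulrC ler_wpM2l//.
  by rewrite (all0 (E z)) (all0 y) !nr0 mulr0.
have [S SP] := choice ex.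
have TS : cancel S T by move=> y; exact: (SP y).1.
have ST : cancel T S.
  by move=> x; apply/eqP; rewrite -subr_eq0; apply/eqP/Tinj; rewrite (linB lT) TS subrr.
have SM : bounded_by (2 * M) S by move=> y; exact: (SP y).2.
have lS : linear S.
  by move=> a u v; apply: (can_inj ST); rewrite lT !TS.
exists S; split=> //; split=> //; exists (2 * M) => v.
by rewrite !normE -rmorphM lecR; exact: SM.
Qed.

End Operators.
(** * Hilbert space projections *)

Section InnerProduct.
Context {R : realType} {H : completeNormedModType R[i]}.
Context {ip : {dot H for (@Num.conj R[i])}} (ip_norm : norm_from_dot ip).
Implicit Types (a : R[i]) (u v w x : H).

Lemma ipDl u v w : ip (u + v) w = ip u w + ip v w.
Proof. exact: linearDl. Qed.

Lemma ipBl u v w : ip (u - v) w = ip u w - ip v w.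
Proof. exact: linearBl. Qed.

Lemma ipZl a u v : ip (a *: u) v = a * ip u v.
Proof. exact: linearZl_LR. Qed.

Lemma ipDr u v w : ip u (v + w) = ip u v + ip u w.
Proof. exact: linearDr. Qed.

Lemma ipBr u v w : ip u (v - w) = ip u v - ip u w.
Proof. exact: linearBr. Qed.

Lemma ipZr a u v : ip u (a *: v) = a^* * ip u v.
Proof. exact: linearZr_LR. Qed.

Lemma ip0l v : ip 0 v = 0.
Proof. exact: linear0l. Qed.

Lemma ip0r v : ip v 0 = 0.
Proof. exact: linear0r. Qed.

Lemma ipC u v : ip u v = (ip v u)^*.
Proof. by rewrite hermC expr0 mul1r. Qed.

Lemma ip_suml n (x : 'I_n -> H) v :
  ip (\sum_(i < n) x i) v = \sum_(i < n) ip (x i) v.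
Proof. by apply: (big_morph (ip^~ v)); [move=> u w; exact: ipDl | exact: ip0l]. Qed.

Lemma ipxx x : ip x x = (nr x ^+ 2)%:C.
Proof. by rewrite -ip_norm normE rmorphXn. Qed.

Lemma nr_ipC u v : nr (ip u v) = nr (ip v u).
Proof. by rewrite ipC nr_conj. Qed.

Lemma nr_sqrD u v :
  nr (u + v) ^+ 2 = nr u ^+ 2 + nr v ^+ 2 + 2 * complex.Re (ip u v).
Proof.
have ReE (z : R) : complex.Re z%:C = z by [].
rewrite -[LHS]ReE -ipxx ipDl !ipDr !ipxx [ip v u]ipC.
by case: (ip u v) => a b; rewrite /=; ring.
Qed.

(** Pythagoras for the projection onto the line of [v]; it yields Cauchy-Schwarz and the almost
    orthogonality of near-minimizers. *)
Lemma nr_sqr_sub_proj u v : v != 0 ->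
  nr (u - (ip u v / ip v v) *: v) ^+ 2 = nr u ^+ 2 - (nr (ip u v) / nr v) ^+ 2.
Proof.
move=> v0; have nv0 : nr v != 0 by rewrite gt_eqF// nr_gt0.
rewrite nr_sqrD nrN nrZ -scaleNr ipZr ipxx.
have -> : (- (ip u v / (nr v ^+ 2)%:C))^* * ip u v =
    (- (nr (ip u v) / nr v) ^+ 2)%:C.
  rewrite rmorphN rmorphM /= fmorphV /= mulNr mulrAC [_^* * _]mulrC -normCK normE.
  rewrite (_ : (((nr v ^+ 2)%:C)^*)%R = (nr v ^+ 2)%:C); last exact: conjc_real.
  by rewrite -rmorphXn -fmorphV -rmorphM -rmorphN expr_div_n.
rewrite nrM (_ : nr ((nr v ^+ 2)%:C)^-1 = (nr v ^+ 2)^-1); last first.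
  by rewrite -fmorphV nrR ger0_norm// invr_ge0 sqr_ge0.
by rewrite /=; field.
Qed.

Lemma cauchy_schwarz u v : nr (ip u v) <= nr u * nr v.
Proof.
have [->|v0] := eqVneq v 0; first by rewrite ip0r !nr0 mulr0.
have := sqr_ge0 (nr (u - (ip u v / ip v v) *: v)).
rewrite nr_sqr_sub_proj// subr_ge0 ler_sqr ?nnegrE ?nr_ge0//; last first.
  by rewrite divr_ge0 ?nr_ge0.
by rewrite ler_pdivrMr ?nr_gt0.
Qed.

Lemma parallelogram u v :
  nr (u + v) ^+ 2 + nr (u - v) ^+ 2 = 2 * nr u ^+ 2 + 2 * nr v ^+ 2.
Proof.
rewrite !nr_sqrD nrN -scaleN1r ipZr rmorphN1 mulN1r.
by case: (ip u v) => a b /=; ring.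
Qed.

Section OrthogonalProjection.
Variable W : set H.
Hypotheses (W0 : W 0) (WD : forall a u v, W u -> W v -> W (a *: u + v)).
Hypothesis closedW : closed W.

Let WB u v : W u -> W v -> W (u - v).
Proof. by move=> Wu Wv; rewrite addrC -scaleN1r; exact: WD. Qed.

Let WZ a u : W u -> W (a *: u).
Proof. by move=> Wu; rewrite -[_ *: _]addr0; exact: WD. Qed.

(** Minimization of the distance from [x] to [W]: the parallelogram law makes near-minimizers a
    Cauchy sequence, and minimality makes [x - l] orthogonal to [W]. *)
Lemma orthogonal_decomposition x :
  exists2 l, W l & forall w, W w -> ip (x - l) w = 0.
Proof.
pose S := [set nr (x - w) ^+ 2 | w in W].
have hS : has_inf S.
  split; first by exists (nr (x - 0) ^+ 2), 0.
  by exists 0 => _ [w _ <-]; exact: sqr_ge0.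
pose D := inf S.
have DW w : W w -> D <= nr (x - w) ^+ 2.
  by move=> Ww; apply: ge_inf; [exact: hS.2 | exists w].
(* The excess over [D] is a square because the parallelogram law bounds squared distances; the
   increments are then geometric. *)
have ex n : exists w, W w /\ nr (x - w) ^+ 2 <= D + (2^-1 ^+ n) ^+ 2.
  have e0 : 0 < (2^-1 ^+ n) ^+ 2 :> R by rewrite !exprn_gt0.
  by have [_ [w Ww <-] /ltW wD] := inf_adherent e0 hS; exists w.
have [w wP] := choice ex.
have h0 n : 0 <= 2^-1 ^+ n :> R by rewrite exprn_ge0.
have [n|l lw] := @geometric_limit _ _ w 2 ltac:(by []).
  rewrite -(ler_sqr (nr_ge0 _)) ?nnegrE ?mulr_ge0//.
  have := parallelogram (x - w n.+1) (x - w n).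
  rewrite (_ : x - w n.+1 - (x - w n) = - (w n.+1 - w n)); last by zmod.
  rewrite nrN (_ : x - w n.+1 + (x - w n) =
    (2 : R)%:C *: (x - (2^-1 : R)%:C *: (w n.+1 + w n))); last first.
    rewrite scalerBr scalerA -rmorphM divff// scale1r.
    by rewrite rmorphD scalerDl !scale1r; zmod.
  rewrite nrZR ger0_norm// exprMn.
  (* The midpoint of [w n.+1] and [w n] lies in [W]. *)
  have := DW ((2^-1 : R)%:C *: (w n.+1 + w n)).
  move=> /(_ ltac:(by apply: WZ; rewrite -[w n.+1]scale1r; apply: WD;
    [exact: (wP _).1 | exact: (wP _).1])).
  have := (wP n).2; have := (wP n.+1).2; rewrite [2^-1 ^+ n.+1]exprS; move: (h0 n).
  have := sqr_ge0 (2^-1 ^+ n : R).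
  lra.
exists l.
  apply: closedW => B /nbhs_ballP [e /= e0 eB].
  have eE : e = (complex.Re e)%:C by rewrite RRe_real// gtr0_real.
  have e1 : 0 < complex.Re e / 2 by rewrite divr_gt0// -ltcR -eE.
  have [n ne] := half_expn_small (2 * 2) e1.
  exists (w n); split; first exact: (wP n).1.
  apply: eB; rewrite -ball_normE /ball_ /= eE nr_lt.
  apply: le_lt_trans (lw n) (le_lt_trans ne _).
  by rewrite ltr_pdivrMr// mulr2n mulrDr mulr1 ltrDl; lra.
move=> v Wv; have [->|v0] := eqVneq v 0; first exact: ip0r.
apply: nr_eq0_small => e e0.
have [n ne] := half_expn_small (5 * nr v) e0; apply: le_trans ne.
have -> : x - l = (x - w n) - (l - w n) by zmod.
rewrite ipBl; apply: le_trans (nrB _ _) _.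
have h1 : nr (ip (x - w n) v) <= 2^-1 ^+ n * nr v.
  (* The competitor moves [w n] by the projection of [x - w n] onto [v]; it can lower the squared
     distance only by the excess over [D]. *)
  have := DW (w n + (ip (x - w n) v / ip v v) *: v).
  rewrite addrC => /(_ (WD _ Wv (wP n).1)).
  rewrite (_ : x - _ = (x - w n) - (ip (x - w n) v / ip v v) *: v); last by zmod.
  rewrite nr_sqr_sub_proj// -ler_pdivrMr ?nr_gt0// => h.
  rewrite -ler_sqr ?nnegrE ?divr_ge0 ?nr_ge0//.
  have := (wP n).2; lra.
have := cauchy_schwarz (l - w n) v; have := lw n; have := nr_ge0 v; nra.
Qed.

Lemma orthogonal_projection : exists P : H -> H,
  [/\ linear P, bounded_by 1 P, forall x, W (P x) & forall x, W x -> P x = x].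
Proof.
have [P WP PW] : exists2 P : H -> H, forall x, W (P x) &
    forall x w, W w -> ip (x - P x) w = 0.
  have /choice[P PP] x : exists l, W l /\ forall w, W w -> ip (x - l) w = 0.
    by have [l] := orthogonal_decomposition x; exists l.
  by exists P => x; [exact: (PP x).1 | exact: (PP x).2].
(* Uniqueness of the decomposition gives both the linearity of [P] and its action on [W]. *)
have uniq x l : W l -> (forall w, W w -> ip (x - l) w = 0) -> P x = l.
  move=> Wl lW; apply/eqP; rewrite -subr_eq0; apply/eqP/nr0_eq0/eqP.
  rewrite -sqrf_eq0; apply/eqP/complexI; rewrite -ipxx.
  have -> : P x - l = (x - l) - (x - P x) by zmod.
  have WPl : W (x - l - (x - P x)).
    by rewrite (_ : _ - _ = P x - l); [exact: WB | zmod].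
  by rewrite {1}ipBl lW// PW// subrr.
exists P; split=> //.
- move=> a u v; apply: uniq => [|w Ww]; first exact: WD.
  rewrite (_ : _ - _ = a *: (u - P u) + (v - P v)); last first.
    by rewrite scalerBr; zmod.
  by rewrite ipDl ipZl !PW// mulr0 addr0.
- move=> x; rewrite mul1r -ler_sqr ?nnegrE ?nr_ge0//.
  have {2}-> : x = (x - P x) + P x by zmod.
  by rewrite nr_sqrD PW//= mulr0 addr0 lerDr sqr_ge0.
- by move=> x Wx; apply: uniq => // w Ww; rewrite subrr ip0l.
Qed.

End OrthogonalProjection.
End InnerProduct.
(** * Finite rank operators and generalized inverses *)

Section FiniteRank.
Context {R : realType} {H : completeNormedModType R[i]}.
Implicit Types (P S : H -> H).

(** Finite sums of maps [f v *: w] with [f] of linear growth, so that closure properties are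
    inductions on the number of terms. Linearity of the whole map is a separate condition. *)
Inductive finite_rank : (H -> H) -> Prop :=
| finite_rank0 : finite_rank (fun=> 0)
| finite_rankS P (f : H -> R[i]) (M : R) (w : H) : finite_rank P ->
    (forall v, nr (f v) <= M * nr v) -> finite_rank (fun v => P v + f v *: w).

Lemma finite_rank_ext P S : finite_rank P -> P =1 S -> finite_rank S.
Proof. by move=> fP /funext <-. Qed.

Lemma finite_rank_bounded P : finite_rank P -> exists2 M : R, 0 <= M & bounded_by M P.
Proof.
elim=> [|{}P f M w _ [M' M'0 PM'] fM].
  by exists 0 => // v; rewrite nr0 mul0r.
exists (M' + `|M| * nr w); first by rewrite addr_ge0// mulr_ge0 ?nr_ge0.
apply: bounded_add => // v; rewrite nrZ mulrAC ler_wpM2r ?nr_ge0//.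
by apply: le_trans (fM v) _; rewrite ler_wpM2r ?nr_ge0// ler_norm.
Qed.

Lemma finite_rank_add P S :
  finite_rank P -> finite_rank S -> finite_rank (fun v => P v + S v).
Proof.
move=> fP; elim=> [|{}S f M w _ IH fM].
  by apply: finite_rank_ext fP _ => v; rewrite addr0.
apply: finite_rank_ext (finite_rankS w IH fM) _ => v.
by rewrite addrA.
Qed.

Lemma finite_rank_compl P S :
  linear S -> finite_rank P -> finite_rank (fun v => S (P v)).
Proof.
move=> lS; elim=> [|{}P f M w _ IH fM].
  by apply: finite_rank_ext finite_rank0 _ => v; rewrite (lin0 lS).
apply: finite_rank_ext (finite_rankS (S w) IH fM) _ => v.
by rewrite (linD lS) (linZ lS).
Qed.

Lemma finite_rank_compr P S (M : R) :
  bounded_by M S -> finite_rank P -> finite_rank (fun v => P (S v)).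
Proof.
move=> SM; elim=> [|{}P f M' w _ IH fM].
  exact: finite_rank0.
apply: (@finite_rankS _ (fun v => f (S v)) (`|M'| * M)) IH _ => v.
apply: le_trans (fM _) _; rewrite -mulrA.
apply: le_trans (_ : `|M'| * nr (S v) <= _); last by rewrite ler_wpM2l.
by rewrite ler_wpM2r ?nr_ge0// ler_norm.
Qed.

Lemma lin_span0 n (v : 'I_n -> H) : lin_span v 0.
Proof. by exists (fun=> 0); rewrite big1// => i _; rewrite scale0r. Qed.

Lemma lin_spanD n (v : 'I_n -> H) (a : R[i]) x y :
  lin_span v x -> lin_span v y -> lin_span v (a *: x + y).
Proof.
move=> [c ->] [d ->]; exists (fun i => a * c i + d i).
rewrite scaler_sumr -big_split; apply: eq_bigr => i _.
by rewrite /= scalerDl scalerA.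
Qed.

Lemma lin_span_gen n (v : 'I_n -> H) i : lin_span v (v i).
Proof.
exists (fun j => (j == i)%:R); rewrite (bigD1 i)//= eqxx scale1r big1 ?addr0// => j.
by move=> /negbTE ->; rewrite scale0r.
Qed.

Lemma lin_span_sub n (v : 'I_n -> H) m (w : 'I_m -> H) :
  (forall i, lin_span w (v i)) -> lin_span v `<=` lin_span w.
Proof.
move=> vw _ [c ->]; apply: (big_ind (lin_span w)); first exact: lin_span0.
  by move=> x y wx wy; rewrite -[x]scale1r; exact: lin_spanD.
by move=> i _; rewrite -[_ *: _]addr0; apply: lin_spanD => //; exact: lin_span0.
Qed.

Lemma lin_span_eq n (v : 'I_n -> H) S T : linear S -> linear T ->
  (forall i, S (v i) = T (v i)) -> forall x, lin_span v x -> S x = T x.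
Proof.
move=> lS lT ST _ [c ->]; rewrite !lin_sum//; apply: eq_bigr => i _.
by rewrite (linZ lS) (linZ lT) ST.
Qed.

Context {ip : {dot H for (@Num.conj R[i])}} (ip_norm : norm_from_dot ip).

(** Gram-Schmidt: the last generator contributes the projection onto its component [w] orthogonal to
    the earlier span. *)
Lemma lin_span_projection n (v : 'I_n -> H) : exists P,
  [/\ linear P, finite_rank P, forall x, lin_span v x -> P x = x &
      forall x, lin_span v (P x)].
Proof.
elim: n v => [|n IH] v.
  exists (fun=> 0); split=> //; first by move=> a x y; rewrite scaler0 addr0.
  - exact: finite_rank0.
  - by move=> _ [c ->]; rewrite big_ord0.
  - by move=> x; exact: lin_span0.
have [P [lP fP Pid Pim]] := IH (fun i => v (widen_ord (leqnSn n) i)).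
pose w := v ord_max - P (v ord_max).
have Pv i : i != ord_max -> P (v i) = v i.
  move=> im; have ilt : (i < n)%N.
    rewrite ltn_neqAle -ltnS ltn_ord andbT; apply: contra im => /eqP ?.
    exact/eqP/val_inj.
  apply: Pid; have -> : i = widen_ord (leqnSn n) (Ordinal ilt) by exact: val_inj.
  exact: (lin_span_gen (fun i => v (widen_ord (leqnSn n) i))).
have Pim' x : lin_span v (P x).
  by apply: lin_span_sub (Pim x) => i; exact: lin_span_gen.
pose f x := ip (x - P x) w / ip w w.
have lS : linear (fun x => P x + f x *: w).
  apply: linear_add => // a x y; rewrite /f lP.
  rewrite (_ : _ - _ = a *: (x - P x) + (y - P y)); last by rewrite scalerBr; zmod.
  by rewrite (ipDl (a *: _)) ipZl mulrDl -mulrA scalerDl scalerA.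
exists (fun x => P x + f x *: w); split.
- exact: lS.
- have [M M0 PM] := finite_rank_bounded fP.
  apply: (@finite_rankS _ _ ((1 + M) * nr w * nr (ip w w)^-1)) fP _ => x.
  rewrite /f nrM mulrAC ler_wpM2r ?nr_ge0//.
  apply: le_trans (cauchy_schwarz ip_norm _ _) _.
  rewrite mulrAC ler_wpM2r ?nr_ge0// mulrDl mul1r.
  by apply: le_trans (nrB _ _) _; rewrite lerD2l PM.
- apply: (@lin_span_eq _ v _ id) => //.
  move=> i; have [->|im] := eqVneq i ord_max; last first.
    by rewrite /f Pv// subrr ip0l mul0r scale0r addr0.
  (* If [w] vanishes, the last generator lies in the earlier span and the added term is zero. *)
  rewrite /f -/w; have [w0|w0] := eqVneq w 0.
    by rewrite w0 scaler0 addr0; apply/eqP; rewrite eq_sym -subr_eq0; exact/eqP.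
  rewrite divff ?scale1r; first by rewrite /w; zmod.
  by rewrite (ipxx ip_norm) fmorph_eq0 expf_eq0 /= gt_eqF// nr_gt0.
- move=> x; rewrite addrC; apply: lin_spanD => //; rewrite /w addrC -scaleN1r.
  by apply: lin_spanD => //; exact: lin_span_gen.
Qed.

Lemma compact_cluster (K : H -> H) (x : nat -> H) : compact_operator K ->
    (forall n, nr (x n) <= 1) ->
  exists y, forall e : R, 0 < e -> forall N, exists2 n, (N <= n)%N & nr (K (x n) - y) < e.
Proof.
move=> [_]; rewrite precompactE => cK x1.
have [|y [_ yc]] := cK ((fun n => K (x n)) @ \oo) _.
  exists 0%N => // n _; apply: subset_closure; exists (x n) => //=.
  by rewrite normE -[1]/((1 : R)%:C) lecR.
exists y => e e0 N.
have [||_ [[n Nn <-]] ] := yc [set K (x n) | n in [set n | (N <= n)%N]] (ball y e%:C).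
- by exists N => // n Nn; exists n.
- by apply: nbhsx_ballx; rewrite ltcR.
rewrite -ball_normE /ball_ /= nr_lt nrBC => ?; by exists n.
Qed.

Lemma nr_eq0_scaled (V : normedZmodType R[i]) (v : V) (M : R) :
  0 <= M -> (forall e : R, 0 < e -> nr v <= M * e) -> v = 0.
Proof.
move=> M0 vM; apply: nr_eq0_small => e e0.
have M1 : 0 < M + 1 by rewrite ltr_wpDl.
(* Division by [M + 1] covers [M = 0]; the same device recurs below. *)
apply: le_trans (vM (e / (M + 1)) ltac:(by rewrite divr_gt0)) _.
by rewrite mulrCA ler_piMr ?(ltW e0)// ler_pdivrMr// mul1r lerDl.
Qed.

(* If [A] were not bounded below on the complement of its kernel, [L] would map
   unit vectors [x_n] with [A x_n -> 0] to [B (A x_n) - x_n], which clusters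
   at some [y] by compactness: [-y] is then a unit vector of that complement
   and lies in the kernel. *)
Lemma bounded_below (A B L P : H -> H) :
    bounded_op A -> bounded_op B -> compact_operator L ->
    (forall v, L v = B (A v) - v) ->
    linear P -> finite_rank P -> (forall v, A v = 0 -> P v = v) ->
  exists2 M : R, 0 <= M & forall x, P x = 0 -> nr x <= M * nr (A x).
Proof.
move=> /bounded_opP [lA [Ma Ma0 AM]] /bounded_opP [lB [Mb Mb0 BM]] cL LE lP.
move=> /finite_rank_bounded [Mp Mp0 PM] Pker.
apply: contrapT => nobound.
(* A vector violating the bound with constant [2 ^+ n] is normalized. *)
have ex (n : nat) : exists x, [/\ P x = 0, nr x = 1 & nr (A x) <= 1 * 2^-1 ^+ n].
  apply: contrapT => nox; apply: nobound; exists (2 ^+ n) => [|x Px].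
    by rewrite exprn_ge0.
  apply/negP => /negP; rewrite -ltNge => xA; apply: nox.
  have x0 : 0 < nr x by apply: le_lt_trans xA; rewrite mulr_ge0 ?exprn_ge0 ?nr_ge0.
  exists ((nr x)^-1%:C *: x); split.
  - by rewrite (linZ lP) Px scaler0.
  - by rewrite nrZR ger0_norm ?mulVf ?gt_eqF// invr_ge0 ltW.
  - rewrite (linZ lA) nrZR ger0_norm ?invr_ge0 ?(ltW x0)//.
    rewrite mul1r exprVn -[leRHS]mul1r ler_pdivlMr ?exprn_gt0//.
    by rewrite -mulrA ler_pdivrMl// mulr1 mulrC ltW.
have [x xP] := choice ex.
have [n|y yx] := compact_cluster cL (x := x); first by have [_ ->] := xP n.
(* Since [y + x n = B (A (x n)) - (L (x n) - y)], [- y] is approximated by unit vectors in the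
   kernel of [P] that [A] nearly annihilates. *)
have near_y e : 0 < e -> exists u, [/\ P u = 0, nr u = 1, nr (A u) <= e &
    nr (y + u) <= (Mb + 1) * e].
  move=> e0; have [N Ne] := half_expn_small 1 e0.
  have [n Nn /ltW Ln] := yx e e0 N; have [Px x1 Ax] := xP n.
  have {}Ax : nr (A (x n)) <= e.
    apply: le_trans Ax (le_trans _ Ne); rewrite !mul1r.
    by rewrite ler_wiXn2l// invf_le1// ler1n.
  exists (x n); split=> //.
  have -> : y + x n = B (A (x n)) - (L (x n) - y) by rewrite LE; zmod.
  apply: le_trans (nrB _ _) _; rewrite mulrDl mul1r lerD//.
  by apply: le_trans (BM _) _; rewrite ler_wpM2l.
have c0 : 0 <= Mb + 1 by rewrite addr_ge0.
have Ay : A y = 0.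
  apply: (@nr_eq0_scaled _ _ (Ma * (Mb + 1) + 1)) => [|e e0].
    by rewrite addr_ge0// mulr_ge0.
  have [u [_ _ Au yu]] := near_y e e0.
  have -> : A y = A (y + u) - A u by rewrite (linD lA); zmod.
  apply: le_trans (nrB _ _) _; rewrite mulrDl mul1r lerD//.
  by apply: le_trans (AM _) _; rewrite -mulrA ler_wpM2l.
have Py : P y = 0.
  apply: (@nr_eq0_scaled _ _ (Mp * (Mb + 1))) => [|e e0]; first by rewrite mulr_ge0.
  have [u [Pu _ _ yu]] := near_y e e0.
  have -> : P y = P (y + u) by rewrite (linD lP) Pu addr0.
  by apply: le_trans (PM _) _; rewrite -mulrA ler_wpM2l.
have y0 : y = 0 by rewrite -Py Pker.
(* With [y = 0], this choice of [e] bounds the norm of a unit vector by [1 / 2]. *)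
have [|u [_ u1 _]] := near_y (2 * (Mb + 1))^-1.
  by rewrite invr_gt0 mulr_gt0// ltr_wpDl.
rewrite y0 add0r u1 invfM mulrCA divff ?gt_eqF ?ltr_wpDl// mulr1.
by rewrite leNgt invf_lt1// ltr1n.
Qed.

(** [P] projects onto the kernel of [A], and [1 - Q] orthogonally onto its closed range. On the
    kernel of [P] the map [A] is injective and bounded below; [C] is its inverse there, precomposed
    with [1 - Q]. *)
Lemma generalized_inverse (A B L : H -> H) :
    fredholm A -> bounded_op B -> compact_operator L ->
    (forall v, L v = B (A v) - v) ->
  exists C P Q : H -> H,
    [/\ bounded_op C, linear P /\ finite_rank P, linear Q /\ finite_rank Q,
        forall v, A (P v) = 0 &
        (forall v, C (A v) = v - P v) /\ (forall v, A (C v) = v - Q v)].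
Proof.
move=> [bA [k [kv kerE]] clA [m [mv mvP]]] bB cL LE; have lA := bA.1.
have [P [lP fP Pid Pim]] := lin_span_projection kv.
have AP v : A (P v) = 0 by have := Pim v; rewrite -kerE.
have Pker v : A v = 0 -> P v = v by move=> Av0; apply: Pid; rewrite -kerE.
have [|||Pr [lPr PrM Prim Prid]] := orthogonal_projection ip_norm (W := range A).
- by exists 0 => //; rewrite (lin0 lA).
- by move=> a _ _ [u _ <-] [v _ <-]; exists (a *: u + v) => //; rewrite lA.
- exact: clA.
pose Q v := v - Pr v.
have lQ : linear Q by apply: linear_sub.
have QM : bounded_by (1 + 1) Q by apply: bounded_sub => // v; rewrite mul1r.
have QA v : Q (A v) = 0 by rewrite /Q Prid ?subrr//; exists v.
have fQ : finite_rank Q.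
  (* [Q] kills the range of [A], so its values lie in the span of the images of the cokernel
     representatives. *)
  have [S [lS fS Sid Sim]] := lin_span_projection (fun i => Q (mv i)).
  apply: finite_rank_ext (finite_rank_compr QM fS) _ => y; apply: Sid.
  have [x [z [c ->] ->]] := mvP y; rewrite (linD lQ) QA add0r (lin_sum _ lQ).
  by exists c; apply: eq_bigr => i _; rewrite (linZ lQ).
have [M M0 below] := bounded_below bA bB cL LE lP fP Pker.
have inj u v : P u = 0 -> P v = 0 -> A u = A v -> u = v.
  move=> Pu Pv Auv; apply/eqP; rewrite -subr_eq0; apply/eqP.
  by rewrite -(Pker (u - v)) ?(linB lP) ?Pu ?Pv ?subrr// (linB lA) Auv subrr.
have /choice[C CP] y : exists x, P x = 0 /\ A x = y - Q y.
  have [x _ Ax] := Prim y; exists (x - P x); split.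
    by rewrite (linB lP) (Pker (P x))// subrr.
  by rewrite (linB lA) AP subr0 Ax /Q; zmod.
have PC y : P (C y) = 0 := (CP y).1.
have AC y : A (C y) = y - Q y := (CP y).2.
exists C, P, Q; split=> //.
  apply/bounded_opP; split.
    move=> a u v; apply: inj; rewrite ?lP ?PC ?scaler0 ?addr0//.
    by rewrite lA !AC lQ (scalerBr a u (Q u)); zmod.
  exists (M * (1 + (1 + 1))); first by rewrite mulr_ge0.
  move=> y; apply: le_trans (below _ (PC y)) _; rewrite AC -mulrA ler_wpM2l//.
  by rewrite mulrDl mul1r; apply: le_trans (nrB _ _) _; rewrite lerD2l.
split=> // v; apply: inj => //; first by rewrite (linB lP) (Pker (P v))// subrr.
by rewrite AC QA (linB lA) AP.
Qed.

End FiniteRank.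
(** * Families of operators *)

Section UniformBoundedness.
Context {R : realType} {H : completeNormedModType R[i]} {I : Type}.

(* Nested balls: on the [n]-th one some member of the family exceeds [n]. *)
Lemma uniform_boundedness (T : I -> H -> H) : (forall i, bounded_op (T i)) ->
    (forall v, exists M : R, forall i, nr (T i v) <= M) ->
  exists2 M : R, 0 <= M & forall i, bounded_by M (T i).
Proof.
move=> bT ptw; apply: contrapT => nobound.
have unb M : 0 <= M -> exists i v, M * nr v < nr (T i v).
  move=> M0; apply: contrapT => no; apply: nobound; exists M => // i v.
  by rewrite leNgt; apply/negP => lt; apply: no; exists i, v.
have step (npr : nat * (H * R)) : exists qs : H * R, 0 < npr.2.2 ->
    [/\ 0 < qs.2, qs.2 <= npr.2.2 / 2, nr (qs.1 - npr.2.1) <= npr.2.2 / 2 &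
        exists i, forall u, nr (u - qs.1) <= qs.2 -> npr.1%:R < nr (T i u)].
  (* The dummy value for a nonpositive radius never occurs in the recursion. *)
  case: npr => n [p r] /=; have [r0|r0] := ltP 0 r; last by exists (p, 0).
  have [|i [v vlt]] := unb ((n.+1%:R + 1) * (2 / r)).
    by rewrite mulr_ge0 ?divr_ge0 ?addr_ge0 ?ltW.
  have [lT [M M0 TM]] := (bounded_opP _).1 (bT i).
  have v0 : 0 < nr v.
    rewrite lt0r nr_ge0 andbT; apply/eqP => v0; have := TM v.
    by move: vlt; rewrite v0 !mulr0; lra.
  pose w := (r / 2 / nr v)%:C *: v.
  have w_r : nr w = r / 2.
    by rewrite nrZR ger0_norm ?divfK ?gt_eqF// !divr_ge0 ?ltW.
  have Tw : n.+1%:R + 1 <= nr (T i w).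
    rewrite (linZ lT) nrZR ger0_norm; last by rewrite !divr_ge0 ?ltW.
    have -> : n.+1%:R + 1 = r / 2 / nr v * ((n.+1%:R + 1) * (2 / r) * nr v).
      by field; rewrite !gt_eqF.
    by rewrite ler_wpM2l ?(ltW vlt)// !divr_ge0 ?ltW.
  (* Twice [T i w] is [T i (p + w) - T i (p - w)], so [p + w] or [p - w] has a large image. *)
  have [q [qp Tq]] : exists q, nr (q - p) <= r / 2 /\ n.+1%:R + 1 <= nr (T i q).
    have [le|gt] := leP (n.+1%:R + 1) (nr (T i (p + w))).
      by exists (p + w); rewrite (_ : _ - _ = w) ?w_r//; zmod.
    exists (p - w); rewrite (_ : _ - _ = - w) ?nrN ?w_r//; last by zmod.
    split=> //; rewrite leNgt; apply/negP => gt'.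
    have : nr (T i w + T i w) <= nr (T i (p + w)) + nr (T i (p - w)).
      apply: le_trans (nrB _ _); rewrite (linD lT) (linB lT) le_eqVlt.
      by apply/orP; left; apply/eqP; congr nr; zmod.
    rewrite (_ : T i w + T i w = (2 : R)%:C *: T i w); last first.
      by rewrite rmorphD scalerDl !scale1r.
    by rewrite nrZR ger0_norm//; lra.
  have M1 : 0 < M + 1 by rewrite ltr_wpDl.
  (* The radius [(M + 1)^-1] limits the change of [T i] on the new ball to 1; [r / 2] keeps this
     ball inside the old one. *)
  exists (q, Num.min (r / 2) (M + 1)^-1) => _ /=; split=> //.
  - by rewrite lt_min divr_gt0//= invr_gt0.
  - by rewrite ge_min lexx.
  exists i => u; rewrite le_min => /andP [_ uq].
  have Tuq : nr (T i (u - q)) <= 1.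
    apply: le_trans (TM _) _; apply: le_trans (_ : M * (M + 1)^-1 <= _).
      by rewrite ler_wpM2l.
    by rewrite ler_pdivrMr// mul1r lerDl.
  have : nr (T i q) <= nr (T i u) + nr (T i (u - q)).
    by apply: le_trans (nrB _ _); rewrite -(linB lT) opprB addrC subrK.
  by move: Tq; rewrite -natr1; lra.
have [g gP] := choice step.
pose pr := fix pr n := if n is m.+1 then g (m, pr m) else (0, 1).
have r0 n : 0 < (pr n).2.
  elim: n => [|n IH] //=; by have [] := gP (n, pr n) IH.
have [l lP] : exists l, forall n, nr (l - (pr n).1) <= (pr n).2.
  apply: cauchy_limit => [e e0|n m nm].
    have [n ne] := half_expn_small 1 e0; exists n; apply: le_trans ne.
    elim: n => [|n IH]; first by rewrite mul1r expr0.
    have [_ + _ _] := gP (n, pr n) (r0 n); rewrite /= !mul1r exprS in IH *; lra.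
  suff : nr ((pr m).1 - (pr n).1) <= (pr n).2 - (pr m).2 by have := r0 m; lra.
  elim: m nm => [|m IH]; first by rewrite leqn0 => /eqP ->; rewrite !subrr nr0.
  rewrite leq_eqVlt ltnS => /predU1P[->|/IH {}IH]; first by rewrite !subrr nr0.
  apply: le_trans (nr_tri _ (pr m).1 _) _.
  by have [_ + + _] := gP (m, pr m) (r0 m); rewrite /=; lra.
have [M lM] := ptw l.
(* At this stage some member exceeds [trunc M + 1], hence [M], at [l]. *)
have [_ _ _ [i iP]] := gP (Num.trunc M + 1, pr (Num.trunc M + 1))%N (r0 _).
have := iP l (lP (Num.trunc M + 1).+1%N); rewrite /= addn1 ltNge.
by rewrite (le_trans (lM i))// ltW// truncnS_gt.
Qed.

End UniformBoundedness.

(** * Families tending to zero in norm or strongly along a filter *)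

Section Families.
Context {R : realType} {H : completeNormedModType R[i]}.
Context {X : Type} {F : set_system X} {FF : Filter F}.
Implicit Types (S T B : X -> H -> H) (P : H -> H).

Definition norm_small T := forall e : R, 0 < e -> \forall x \near F, bounded_by e (T x).

Definition strongly_small T :=
  forall v (e : R), 0 < e -> \forall x \near F, nr (T x v) <= e.

Definition uniformly_bounded T := exists2 M : R, 0 <= M & forall x, bounded_by M (T x).

Lemma norm_small_ext S T : norm_small S -> (forall x v, S x v = T x v) -> norm_small T.
Proof. by move=> sS ST; suff <- : S = T by []; apply/funext => x; apply/funext. Qed.

Lemma norm_small_add S T :
  norm_small S -> norm_small T -> norm_small (fun x v => S x v + T x v).
Proof.
move=> sS sT e e0; have e2 : 0 < e / 2 by rewrite divr_gt0.
near=> x; rewrite (splitr e); apply: bounded_add; near: x; [exact: sS|exact: sT].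
Unshelve. all: by end_near. Qed.

Lemma norm_small_sub S T :
  norm_small S -> norm_small T -> norm_small (fun x v => S x v - T x v).
Proof.
move=> sS sT e e0; have e2 : 0 < e / 2 by rewrite divr_gt0.
near=> x; rewrite (splitr e); apply: bounded_sub; near: x; [exact: sS|exact: sT].
Unshelve. all: by end_near. Qed.

Lemma norm_small_compl B T :
  uniformly_bounded B -> norm_small T -> norm_small (fun x v => B x (T x v)).
Proof.
move=> [M M0 BM] sT e e0; have M1 : 0 < M + 1 by rewrite ltr_wpDl.
near=> x; apply: (@bounded_le _ _ ((M + 1) * (e / (M + 1)))).
  by rewrite mulrCA divff ?gt_eqF// mulr1.
apply: bounded_comp; first exact: ltW.
  by apply: bounded_le (BM x); rewrite lerDl.
by near: x; apply: sT; rewrite divr_gt0.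
Unshelve. all: by end_near. Qed.

Lemma norm_small_compr T B :
  norm_small T -> uniformly_bounded B -> norm_small (fun x v => T x (B x v)).
Proof.
move=> sT [M M0 BM] e e0; have M1 : 0 < M + 1 by rewrite ltr_wpDl.
near=> x; apply: (@bounded_le _ _ ((e / (M + 1)) * (M + 1))).
  by rewrite divfK ?gt_eqF.
apply: bounded_comp; first by rewrite divr_ge0 ?ltW.
  by near: x; apply: sT; rewrite divr_gt0.
by apply: bounded_le (BM x); rewrite lerDl.
Unshelve. all: by end_near. Qed.

(** By induction on the rank: [T x (f v *: w) = f v *: T x w] involves [T x] only at the fixed
    vector [w]. *)
Lemma norm_small_finite_rank T P : (forall x, linear (T x)) ->
  strongly_small T -> finite_rank P -> norm_small (fun x v => T x (P v)).
Proof.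
move=> lT sT; elim=> [|{}P f M w _ IH fM].
  move=> e e0; apply: nearW => x v; rewrite (lin0 (lT x)) nr0.
  by rewrite mulr_ge0 ?nr_ge0 ?(ltW e0).
apply: norm_small_ext (norm_small_add IH (_ : norm_small (fun x v => f v *: T x w))) _.
  move=> e e0; have M1 : 0 < `|M| + 1 by rewrite ltr_wpDl.
  near=> x => v; rewrite nrZ.
  apply: le_trans (_ : (`|M| + 1) * nr v * (e / (`|M| + 1)) <= _); last first.
    by rewrite mulrAC [_ * (e / _)]mulrC divfK ?gt_eqF.
  apply: ler_pM; rewrite ?nr_ge0//.
    apply: le_trans (fM v) _; rewrite ler_wpM2r ?nr_ge0//.
    by apply: le_trans (ler_norm _) _; rewrite lerDl.
  by near: x; apply: sT; rewrite divr_gt0.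
by move=> x v; rewrite (linD (lT x)) (linZ (lT x)).
Unshelve. all: by end_near. Qed.

Lemma uniformly_bounded_cst (A : H -> H) : bounded_op A -> uniformly_bounded (fun=> A).
Proof. by move=> /bounded_opP [_ [M M0 AM]]; exists M. Qed.

Lemma uniformly_bounded_finite_rank P : finite_rank P -> uniformly_bounded (fun=> P).
Proof. by move=> /finite_rank_bounded [M M0 PM]; exists M. Qed.

Lemma uniformly_bounded_comp S T : uniformly_bounded S -> uniformly_bounded T ->
  uniformly_bounded (fun x v => S x (T x v)).
Proof.
move=> [M M0 SM] [M' M'0 TM]; exists (M * M') => [|x]; first exact: mulr_ge0.
exact: bounded_comp.
Qed.

Lemma uniformly_bounded_add S T : uniformly_bounded S -> uniformly_bounded T ->
  uniformly_bounded (fun x v => S x v + T x v).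
Proof.
move=> [M M0 SM] [M' M'0 TM]; exists (M + M') => [|x]; first exact: addr_ge0.
exact: bounded_add.
Qed.

Lemma uniformly_bounded_sub S T : uniformly_bounded S -> uniformly_bounded T ->
  uniformly_bounded (fun x v => S x v - T x v).
Proof.
move=> [M M0 SM] [M' M'0 TM]; exists (M + M') => [|x]; first exact: addr_ge0.
exact: bounded_sub.
Qed.

Lemma uniformly_bounded_id : uniformly_bounded (fun _ v => v).
Proof. by exists 1 => // _ v; rewrite mul1r. Qed.

Lemma uniformly_bounded_op T :
  (forall x, linear (T x)) -> uniformly_bounded T -> forall x, bounded_op (T x).
Proof. by move=> lT [M M0 TM] x; apply/bounded_opP; split=> //; exists M. Qed.

Context {ip : {dot H for (@Num.conj R[i])}} (ip_norm : norm_from_dot ip).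

(* [T - (T - 1) P], with [P] a projection onto the span of [v], is norm-close to
   [T] and fixes that span; [S] is its inverse. *)
Lemma local_equivalence (A T E G : X -> H -> H) (A0 : H -> H) :
    (forall x, linear (T x)) -> (forall x, linear (E x)) -> (forall x, linear (G x)) ->
    bounded_op A0 ->
    uniformly_bounded T -> uniformly_bounded E -> uniformly_bounded G ->
    strongly_small (fun x v => T x v - v) ->
    norm_small (fun x v => T x (E x v) - v) ->
    norm_small (fun x v => G x (T x v) - v) ->
    norm_small (fun x v => T x (A0 v) - A x v) ->
  forall n (v : 'I_n -> H) (e : R), 0 < e -> \forall x \near F, exists S : H -> H,
    [/\ invertible_op S, forall u, lin_span v u -> S u = u &
        bounded_by e (fun u => S (A x u) - A0 u)].
Proof.
move=> lT lE lG bA0 uT uE uG sT TE GT TA n v e e0.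
have [P [lP fP Pid _]] := lin_span_projection ip_norm v.
have TP : norm_small (fun x u => T x (P u) - P u).
  by apply: (norm_small_finite_rank (T := fun x u => T x u - u)) => // x;
    apply: linear_sub.
pose T' x u := T x u - (T x (P u) - P u).
have lT' x : linear (T' x).
  apply: linear_sub => //; apply: linear_sub => //; exact: linear_comp.
have uP := uniformly_bounded_finite_rank fP.
have uT' : uniformly_bounded T'.
  by apply: uniformly_bounded_sub => //; apply: uniformly_bounded_sub => //;
    apply: uniformly_bounded_comp.
have T'E : norm_small (fun x u => T' x (E x u) - u).
  apply: norm_small_ext (norm_small_sub TE (norm_small_compr TP uE)) _ => x u.
  by rewrite /T'; zmod.
have GT' : norm_small (fun x u => G x (T' x u) - u).
  apply: norm_small_ext (norm_small_sub GT (norm_small_compl uG TP)) _ => x u.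
  by rewrite /T' !(linB (lG x)); zmod.
have T'A : norm_small (fun x u => T' x (A0 u) - A x u).
  have uA0 := uniformly_bounded_cst bA0.
  apply: norm_small_ext (norm_small_sub TA (norm_small_compr TP uA0)) _ => x u.
  by rewrite /T'; zmod.
have [M M0 EM] := uE; have M1 : 0 < 2 * (M + 1) by rewrite mulr_gt0// ltr_wpDl.
near=> x.
have [||||||S [bS T'S ST' SM]] := @approx_inverse _ _ (T' x) (E x) (G x) M.
- exact: uniformly_bounded_op.
- exact: lE.
- exact: lG.
- exact: EM.
- by near: x; apply: T'E; rewrite invr_gt0.
- by near: x; apply: GT'; rewrite invr_gt0.
exists S; split.
- by split=> //; exists (T' x); split=> //; exact: uniformly_bounded_op.
- by move=> u vu; rewrite -{1}[u](_ : T' x u = u) ?T'S// /T' Pid//; zmod.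
have [lS _] := bS.
(* Writing [A0 u] as [S (T' x (A0 u))] puts the bounded map [S] in front of a norm small
   difference. *)
have -> : (fun u => S (A x u) - A0 u) = (fun u => S (A x u - T' x (A0 u))).
  by apply/funext => u; rewrite (linB lS) T'S.
apply: (@bounded_le _ _ (2 * (M + 1) * (e / (2 * (M + 1))))).
  by rewrite mulrCA divff ?gt_eqF// mulr1.
apply: bounded_comp; first exact: ltW.
  by apply: bounded_le SM; rewrite ler_wpM2l// lerDl.
move=> u; rewrite nrBC; move: u; near: x; apply: T'A; rewrite divr_gt0//.
Unshelve. all: by end_near. Qed.

End Families.
(** * The F-topology and parametrices *)

Section Topologies.
Context {R : realType} {H : completeNormedModType R[i]}.

Lemma unit_ballE (x : H) : (`|x| <= 1) = (nr x <= 1).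
Proof. by rewrite normE -[1]/((1 : R)%:C) lecR. Qed.

Lemma le_opnorm (T : H -> H) x : bounded_op T -> nr x <= 1 -> nr (T x) <= opnorm T.
Proof.
move=> /bounded_opP [lT [M M0 TM]] x1; apply: ub_le_sup.
  exists M => _ [y /= + <-]; rewrite unit_ballE => y1.
  by apply: le_trans (TM y) _; rewrite ler_piMr.
by exists x; rewrite //= unit_ballE.
Qed.

Lemma opnorm_ge0 (T : H -> H) : bounded_op T -> 0 <= opnorm T.
Proof.
by move=> bT; apply: le_trans (le_opnorm (x := 0) bT _); rewrite ?nr_ge0 ?nr0.
Qed.

Lemma opnorm_bounded (T : H -> H) (e : R) :
  bounded_op T -> opnorm T < e -> bounded_by e T.
Proof.
move=> bT Te v; have lT := bT.1.
have [->|v0] := eqVneq v 0; first by rewrite (lin0 lT) nr0 mulr0.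
have v1 := nr_gt0 v0.
rewrite -ler_pdivrMr//; apply: le_trans (ltW Te).
have := le_opnorm (x := (nr v)^-1%:C *: v) bT.
rewrite (linZ lT) !nrZR ger0_norm ?invr_ge0 ?(ltW v1)// mulVf ?gt_eqF//.
by rewrite mulrC; apply.
Qed.

Lemma opnorm_le (T : H -> H) (e : R) : 0 <= e -> bounded_by e T -> opnorm T <= e.
Proof.
move=> e0 Te; apply: ge_sup; first by exists (nr (T 0)), 0 => //=; rewrite normr0.
move=> _ [x /= + <-]; rewrite unit_ballE => x1.
by apply: le_trans (Te x) _; rewrite ler_piMr.
Qed.

Lemma invertible_op_comp (S T : H -> H) :
  invertible_op S -> invertible_op T -> invertible_op (S \o T).
Proof.
move=> [bS [S' [bS' S'S SS']]] [bT [T' [bT' T'T TT']]].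
have bcomp U V : bounded_op U -> bounded_op V -> bounded_op (U \o V : H -> H).
  move=> /bounded_opP [lU [M M0 UM]] /bounded_opP [lV [M' M'0 VM]].
  apply/bounded_opP; split; first exact: linear_comp.
  by exists (M * M'); [exact: mulr_ge0 | exact: bounded_comp].
split; first exact: bcomp.
exists (T' \o S'); split; first exact: bcomp.
  by move=> x /=; rewrite S'S T'T.
by move=> x /=; rewrite TT' SS'.
Qed.

Lemma strongly_continuousP (X : topologicalType) (A : X -> fredholm_op H) x0 :
  strongly_continuous A ->
  @strongly_small R H X (nbhs x0) (fun x v => A x v - A x0 v).
Proof.
move=> cA v e e0.
have : (fun x => fredholm_fun (A x) : {ptws H -> H}) @ x0 -->
    (fredholm_fun (A x0) : {ptws H -> H}).
  have cf := @initial_continuous (fredholm_op H) {ptws H -> H} (@fredholm_fun R H) (A x0).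
  by move=> B /cf; exact: cA.
move/pointwise_cvgP => /(_ v) /cvgrPdist_le /(_ e%:C); rewrite ltcR => /(_ e0).
by move=> h; apply: (@filterS X (nbhs x0) _ _ _ _ h) => x /=; rewrite normE lecR nrBC.
Qed.

Lemma uniform_continuousP (X : topologicalType) (K : X -> compact_op H) x0 :
  continuous (K : X -> compact_uniform H) ->
  @norm_small R H X (nbhs x0) (fun x v => K x v - K x0 v).
Proof.
move=> cK e e0.
pose U := [set L : compact_op H | opnorm (compact_fun L \- compact_fun (K x0)) < e].
have bK x : bounded_op (K x) := (compact_opP (K x)).1.
have KB x y : bounded_op (compact_fun (K x) \- compact_fun (K y)).
  have /bounded_opP [lx [M M0 xM]] := bK x.
  have /bounded_opP [ly [M' M'0 yM]] := bK y.
  apply/bounded_opP; split; first exact: linear_sub.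
  by exists (M + M'); [exact: addr_ge0 | exact: bounded_sub].
have : nbhs (K x0 : compact_uniform H) U.
  apply: open_nbhs_nbhs; split.
    exists [set U]; last by rewrite bigcup_set1.
    by move=> _ ->; apply: (@finI_from1 _ _ _ id); exists e, (K x0).
  rewrite /U /=; apply: le_lt_trans (_ : e / 2 < e); last by lra.
  have e2 : 0 <= e / 2 by rewrite divr_ge0 ?ltW.
  by apply: opnorm_le => // v /=; rewrite subrr nr0; exact: mulr_ge0 e2 (nr_ge0 v).
move/(cK x0) => h; apply: (@filterS X (nbhs x0) _ _ _ _ h) => x.
exact: (opnorm_bounded (KB x x0)).
Qed.

(** If [T] witnesses that [A x0] lies in a subbasic set for [V], then [T \o S] does so for [A x]:
    [S] fixes [V] pointwise, and [S \o A x] is norm close to [A x0]. *)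
Lemma F_continuousP (X : topologicalType) (A : X -> fredholm_op H) x0 :
    @strongly_small R H X (nbhs x0) (fun x v => A x v - A x0 v) ->
    (forall n (v : 'I_n -> H) (e : R), 0 < e -> \forall x \near x0, exists S : H -> H,
      [/\ invertible_op S, forall u, lin_span v u -> S u = u &
          bounded_by e (fun u => S (A x u) - A x0 u)]) ->
  {for x0, continuous (A : X -> fredholm_F H)}.
Proof.
move=> sA eA V [U [[D' sD' <-] [W D'W Wx] UV]].
apply: (@filterS _ (nbhs x0) _ (A @^-1` W)).
  by move=> x Wx'; apply: UV; exists W.
have [I sI WE] := sD' _ D'W; rewrite -WE in Wx *.
rewrite /preimage; apply: filter_bigI => i Ii.
have := Wx i Ii; have /set_mem := sI _ Ii; rewrite /=.
case=> [[e [A1 [n [a [e0 ->]]]]] Aa|[e [A1 [_ [e0 [n [v ->]] ->]]]] [T [iT TV lt]]].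
  apply: filter_forall => j.
  have := Aa j; rewrite nr_lt => lt.
  have d0 : 0 < (e - nr (A x0 (a j) - A1 (a j))) / 2 by rewrite divr_gt0// subr_gt0.
  apply: filterS (sA (a j) _ d0) => x xd; rewrite nr_lt.
  by apply: le_lt_trans (nr_tri _ (A x0 (a j)) _) _; lra.
have [bT _] := iT; have /bounded_opP [lT [M M0 TM]] := bT.
have M1 : 0 < M + 1 by rewrite ltr_wpDl.
(* [d] is half the gap between [o] and [e]; the errors [d / 2], due to the strict bound in
   [opnorm_bounded], and [d] fit into the gap. *)
pose o := opnorm ((T \o A x0) \- A1); pose d := (e - o) / 2.
have d0 : 0 < d by rewrite divr_gt0// subr_gt0.
have d1 : 0 < d / (M + 1) by rewrite divr_gt0.
apply: (@filterS X (nbhs x0) _ _ _ _ (eA n v _ d1)) => x [S [iS Sv SA]].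
exists (T \o S); split; first exact: invertible_op_comp.
  by move=> _ [u vu <-] /=; rewrite (Sv _ vu); apply: TV; exists u.
have bA1 : bounded_op (A1 : H -> H) by have [] := fredholm_opP A1.
have bA0 : bounded_op (A x0 : H -> H) by have [] := fredholm_opP (A x0).
have bTA : bounded_op ((T \o A x0) \- A1).
  apply/bounded_opP; have /bounded_opP [lA0 [M' M'0 A0M]] := bA0.
  have /bounded_opP [lA1 [M2 M20 A1M]] := bA1.
  split; first exact: linear_sub (linear_comp lT lA0) lA1.
  exists (M * M' + M2); first by rewrite addr_ge0// mulr_ge0.
  apply: bounded_sub A1M; exact: bounded_comp.
have od : bounded_by (o + d / 2) ((T \o A x0) \- A1).
  by apply: opnorm_bounded => //; rewrite ltrDl divr_gt0.
have o0 : 0 <= o := opnorm_ge0 bTA.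
have oe : o < e := lt.
apply: (@le_lt_trans _ _ (o + d / 2 + d)); last by rewrite /d; lra.
apply: opnorm_le => [|u]; first by lra.
rewrite /=.
have -> : T (S (A x u)) - A1 u = (T (A x0 u) - A1 u) + T (S (A x u) - A x0 u).
  by rewrite (linB lT); zmod.
apply: le_trans (nrD _ _) _; rewrite mulrDl lerD//; first exact: od.
apply: le_trans (TM _) _; apply: le_trans (_ : (M + 1) * (d / (M + 1) * nr u) <= _).
  by apply: ler_pM; rewrite ?nr_ge0 ?lerDl//; exact: SA.
by rewrite mulrA mulrCA divff ?gt_eqF// mulr1.
Qed.

End Topologies.

(** * A parametrix implies continuity in the F-topology *)

Section Parametrices.
Context {R : realType} {H : completeNormedModType R[i]}.
Context {ip : {dot H for (@Num.conj R[i])}} (ip_norm : norm_from_dot ip).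
Context {X : topologicalType} (X_compact : compact [set: X]).

Lemma fredholm_bounded (A : fredholm_op H) : bounded_op A.
Proof. by have [] := fredholm_opP A. Qed.

(** For fixed [v], strong continuity bounds [A x v] locally in [x], hence on the whole compact
    space; uniform boundedness then applies. *)
Lemma strongly_continuous_bounded (A : X -> fredholm_op H) :
  strongly_continuous A -> uniformly_bounded A.
Proof.
move=> cA; apply: uniform_boundedness => [x|v]; first exact: fredholm_bounded.
have /compact_near_coveringP cX := X_compact.
(* Compactness enters in near-covering form, with the bound [M] tending to infinity as parameter. *)
have [|M MA] := @filter_ex R +oo _ _ (cX R +oo (fun M x => nr (A x v) <= M) _ _).
  move=> x _; have near1 := strongly_continuousP x cA v (ltr01 : 0 < (1 : R)).
  exists ([set y | nr (A y v - A x v) <= 1], [set M | nr (A x v) + 1 <= M]).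
    by split=> //=; exact: nbhs_pinfty_ge (num_real _).
  move=> [y M] /= [yx xM]; apply: le_trans xM.
  have := nr_tri (A y v) (A x v) 0; rewrite !subr0; lra.
by exists M => x; exact: MA.
Qed.

(* Near [x0] the operators [T x] form approximate equivalences between [A x0]
   and [A x]: [E x] and [G x] are approximate right and left inverses of [T x],
   built from [B x]. *)
Theorem parametrix_maps_F_continuous :
  parametrix_maps H X `<=` F_continuous_maps H X.
Proof.
move=> A [sA [B [sB [K [L [KE LE cK cL]]]]]] x0.
have KE' x v : K x v = A x (B x v) - v by rewrite KE.
have LE' x v : L x v = B x (A x v) - v by rewrite LE.
have bA x := fredholm_bounded (A x); have bB x := fredholm_bounded (B x).
have lA x := (bA x).1; have lB x := (bB x).1.
have uA := strongly_continuous_bounded sA; have uB := strongly_continuous_bounded sB.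
have ssA := strongly_continuousP x0 sA.
have ssB := strongly_continuousP x0 sB.
have [C [P [Q [bC [lP fP] [lQ fQ] AP [CA AC]]]]] :=
  generalized_inverse ip_norm (fredholm_opP (A x0)) (bB x0)
    (compact_opP (L x0)) (LE' x0).
(* The roles of [A] and [B] are exchanged: [G] is a generalized inverse of [B x0]. *)
have [G [P' [Q' [bG [lP' fP'] [lQ' fQ'] BP [GB BG]]]]] :=
  generalized_inverse ip_norm (fredholm_opP (B x0)) (bA x0)
    (compact_opP (K x0)) (KE' x0).
have lC := bC.1; have lG := bG.1.
have uC := uniformly_bounded_cst (X := X) bC.
have uG := uniformly_bounded_cst (X := X) bG.
have uQ := uniformly_bounded_finite_rank (X := X) fQ.
(* The finite rank defect in [A x0 (B x0 (G (C v))) = v - Q2 v]. *)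
pose Q2 v := Q v + A x0 (Q' (C v)).
have lQ2 : linear Q2.
  by apply: linear_add => //; apply: linear_comp => //; apply: linear_comp.
have fQ2 : finite_rank Q2.
  apply: finite_rank_add => //; apply: (finite_rank_compl (lA x0)).
  have /bounded_opP [_ [M _ CM]] := bC; exact: (finite_rank_compr CM).
have uQ2 := uniformly_bounded_finite_rank (X := X) fQ2.
have QA v : Q (A x0 v) = 0.
  have := AC (A x0 v); rewrite CA (linB (lA x0)) AP subr0 => eq.
  have -> : Q (A x0 v) = A x0 v - (A x0 v - Q (A x0 v)) by zmod.
  by rewrite -eq subrr.
have FF := nbhs_filter x0.
have smallA : forall x, linear (fun v => A x v - A x0 v) by move=> x; apply: linear_sub.
have smallB : forall x, linear (fun v => B x v - B x0 v) by move=> x; apply: linear_sub.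
have nA S (fS : finite_rank S) := norm_small_finite_rank (FF := FF) smallA ssA fS.
have nB S (fS : finite_rank S) := norm_small_finite_rank (FF := FF) smallB ssB fS.
pose T x v := A x (C v) + Q v.
pose E x v := A x0 (B x (G (C v))) + Q2 v.
(* Here [F x (T x v) - v] is [T x - 1] applied to [v - G (B x (T x v))], which is norm close to the
   finite rank [P' v]. *)
pose F x v := v + (G (B x v) - T x (G (B x v))).
have lT x : linear (T x) by apply: linear_add => //; exact: linear_comp.
have lE x : linear (E x).
  apply: linear_add => //; apply: linear_comp => //; apply: linear_comp => //.
  exact: linear_comp.
have lF x : linear (F x).
  have lGB : linear (fun v => G (B x v)) by exact: linear_comp.
  apply: linear_add => //; apply: linear_sub => //; exact: linear_comp.
have uT : uniformly_bounded T.
  exact: uniformly_bounded_add (uniformly_bounded_comp uA uC) uQ.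
have uGC := uniformly_bounded_comp uG uC.
have uBG := uniformly_bounded_comp uB uGC.
have uE : uniformly_bounded E.
  apply: uniformly_bounded_add uQ2.
  exact: uniformly_bounded_comp (uniformly_bounded_cst (bA x0)) uBG.
have uGB := uniformly_bounded_comp uG uB.
have uF : uniformly_bounded F.
  apply: uniformly_bounded_add; first exact: uniformly_bounded_id.
  exact: uniformly_bounded_sub uGB (uniformly_bounded_comp uT uGB).
apply: F_continuousP => //.
apply: (local_equivalence ip_norm lT lE lF (bA x0) uT uE uF).
- move=> v e e0; have := ssA (C v) e e0; apply: filterS => x.
  suff -> : A x (C v) - A x0 (C v) = T x v - v by [].
  by rewrite AC /T; zmod.
(* The error of [T x \o E x] is the sum of [(K x - K x0) G C], [- (A x - A x0) P (B x) G C] and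
   [(A x - A x0) C Q2]; the finite rank of [P] and [Q2] turns strong smallness into norm
   smallness. *)
- have s1 := norm_small_compr (FF := FF) (uniform_continuousP x0 cK) uGC.
  have s2 := norm_small_compr (FF := FF) (nA _ fP) uBG.
  have s3 := nA _ (finite_rank_compl lC fQ2).
  apply: norm_small_ext (norm_small_add (norm_small_sub s1 s2) s3) _ => x v.
  rewrite /T /E !KE' (linD lQ (A x0 _)) QA (linD lC (A x0 _)) CA AC BG.
  rewrite (linD (lA x) _ (C _)) (linB (lA x)) AP (linB (lA x0)) AC /Q2 (linD lQ).
  by zmod.
- have nr1 := norm_small_add (FF := FF)
    (norm_small_compr (FF := FF) (uniform_continuousP x0 cL) uC) (nB _ fQ).
  have sT : strongly_small (F := nbhs x0) (fun x v => T x v - v).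
    move=> v e e0; have := ssA (C v) e e0; apply: filterS => x.
    suff -> : A x (C v) - A x0 (C v) = T x v - v by [].
    by rewrite AC /T; zmod.
  have lT1 x : linear (fun v => T x v - v) by apply: linear_sub.
  have nGr := norm_small_compl (FF := FF) uG nr1.
  apply: norm_small_ext (norm_small_add (norm_small_finite_rank lT1 sT fP')
    (norm_small_sub nGr (norm_small_compl uT nGr))) _ => x v.
  (* The norm small error in [B x (T x v) = B x0 v + r], from [B x (A x w) = w + L x w]. *)
  pose r := L x (C v) - L x0 (C v) + (B x (Q v) - B x0 (Q v)).
  have BT : B x (T x v) = B x0 v + r.
    rewrite /r !LE' /T (linD (lB x)) AC (linB (lB x0)); zmod.
  rewrite -/r; clearbody r.
  by rewrite /F BT (linD lG) GB !(linD (lT x)) (linN (lT x)); zmod.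
- have fNP : finite_rank (fun v => - P v).
    by apply: finite_rank_compl fP => a u v; rewrite opprD scalerN.
  apply: norm_small_ext (nA _ fNP) _ => x v.
  rewrite /T QA CA (linB (lA x)) !(linN (lA _)) AP; zmod.
Qed.

End Parametrices.
(** * A family without parametrix *)

Section OrthonormalSequences.
Context {R : realType} {H : completeNormedModType R[i]}.
Context {ip : {dot H for (@Num.conj R[i])}} (ip_norm : norm_from_dot ip).

Lemma closed_approx (W : set H) :
    (forall x, (forall e : R, 0 < e -> exists2 y, W y & nr (x - y) <= e) -> W x) ->
  closed W.
Proof.
move=> Wapp x clx; apply: Wapp => e e0.
have [|y [Wy]] := clx (ball x e%:C); first by apply: nbhsx_ballx; rewrite ltcR.
by rewrite -ball_normE /ball_ /= nr_lt => /ltW ?; exists y.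
Qed.

Lemma lin_span_closed n (v : 'I_n -> H) : closed (lin_span v).
Proof.
have [P [lP fP Pid Pim]] := lin_span_projection ip_norm v.
have [M M0 PM] := finite_rank_bounded fP.
apply: closed_approx => x xapp.
suff <- : P x = x by [].
apply/eqP; rewrite -subr_eq0; apply/eqP.
apply: (@nr_eq0_scaled _ _ _ (M + 1)) => [|e e0]; first by rewrite addr_ge0.
have [y vy xy] := xapp e e0.
have -> : P x - x = P (x - y) - (x - y) by rewrite (linB lP) (Pid _ vy); zmod.
apply: le_trans (nrB _ _) _; rewrite mulrDl mul1r lerD//.
by apply: le_trans (PM _) _; rewrite ler_wpM2l.
Qed.

Definition orthonormal_sequence (e : nat -> H) :=
  forall m n, ip (e m) (e n) = (m == n)%:R.

Hypothesis H_infinite_dim : ~ fin_dim_subspace [set: H].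

(** Infinite dimension gives a vector outside the span of [s]; its component orthogonal to this
    closed span is normalized. *)
Lemma unit_orthogonal (s : seq H) : exists e, nr e = 1 /\ forall y, y \in s -> ip e y = 0.
Proof.
pose v (i : 'I_(size s)) := s`_i.
have [x nx] : exists x, ~ lin_span v x.
  apply: contrapT => all; apply: H_infinite_dim; exists (size s), v.
  apply/seteqP; split=> // x _; apply: contrapT => nx; apply: all; by exists x.
have [|||l vl ortho] := orthogonal_decomposition ip_norm (W := lin_span v) _ _ _ x.
- exact: lin_span0.
- by move=> a u w; exact: lin_spanD.
- exact: lin_span_closed.
have xl : x - l != 0 by rewrite subr_eq0; apply/eqP => xl; apply: nx; rewrite xl.
exists ((nr (x - l))^-1%:C *: (x - l)); split.
  by rewrite nrZR ger0_norm ?invr_ge0 ?nr_ge0// mulVf// gt_eqF// nr_gt0.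
move=> y ys; rewrite ipZl ortho ?mulr0//.
have ilt : (index y s < size s)%N by rewrite index_mem.
by rewrite -(nth_index 0 ys) -[nth _ _ _]/(v (Ordinal ilt)); exact: lin_span_gen.
Qed.

Lemma exists_orthonormal_sequence : exists e, orthonormal_sequence e.
Proof.
have [g gP] := choice unit_orthogonal.
(* [s n] lists the first [n] vectors, and the next one is orthogonal to all of them. *)
pose s := fix s n := if n is m.+1 then rcons (s m) (g (s m)) else [::].
have mem_s m n : (m < n)%N -> g (s m) \in s n.
  elim: n => // n IH; rewrite ltnS leq_eqVlt => /predU1P [->|/IH mn] /=.
    by rewrite mem_rcons inE eqxx.
  by rewrite mem_rcons inE mn orbT.
exists (fun n => g (s n)) => m n.
have [->|mn] := eqVneq m n; first by rewrite (ipxx ip_norm) (gP _).1 expr1n.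
have [lt|lt|eq] := ltngtP m n; last by rewrite eq eqxx in mn.
  by rewrite ipC (gP _).2 ?conjC0// mem_s.
by rewrite (gP _).2// mem_s.
Qed.

Context {e : nat -> H} (e_on : orthonormal_sequence e).

Lemma orthonormal_nr n : nr (e n) = 1.
Proof.
have := e_on n n; rewrite eqxx (ipxx ip_norm) => /complexI/eqP.
by rewrite sqrp_eq1 ?nr_ge0// => /eqP.
Qed.

Lemma nr_sqr_orthonormal_sum (a : nat -> R[i]) n :
  nr (\sum_(i < n) a i *: e i) ^+ 2 = \sum_(i < n) nr (a i) ^+ 2.
Proof.
elim: n => [|n IH]; first by rewrite !big_ord0 nr0 expr0n.
rewrite !big_ord_recr /= (nr_sqrD ip_norm) IH nrZ orthonormal_nr mulr1.
suff -> : ip (\sum_(i < n) a i *: e i) (a n *: e n) = 0 by rewrite mulr0 addr0.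
rewrite ip_suml big1// => i _.
by rewrite ipZl ipZr e_on ltn_eqF// !mulr0.
Qed.

(** On the combination [v n] of the [e i] with the conjugates of the [f (e i)] as coefficients, [f]
    takes the value [nr (v n) ^+ 2], whence [nr (v n) <= M] unless [v n] vanishes. *)
Lemma bessel (f : H -> R[i]) (M : R) n : (forall a u v, f (a *: u + v) = a * f u + f v) ->
    (forall v, nr (f v) <= M * nr v) ->
  \sum_(i < n) nr (f (e i)) ^+ 2 <= M ^+ 2.
Proof.
move=> lf fM; pose v k : H := \sum_(i < k) (f (e i))^* *: e i.
have f0 : f 0 = 0 by have := lf (-1) 0 0; rewrite scaler0 addr0 mulN1r addNr.
have fv k : f (v k) = (\sum_(i < k) nr (f (e i)) ^+ 2)%:C.
  elim: k => [|k IH]; first by rewrite /v !big_ord0 f0.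
  rewrite /v !big_ord_recr /= addrC lf -/(v k) IH rmorphD /= addrC; congr (_ + _).
  by rewrite mulrC -normCK normE rmorphXn.
set s := \sum_(i < n) _; have s0 : 0 <= s by apply: sumr_ge0 => i _; exact: sqr_ge0.
have vs : nr (v n) ^+ 2 = s.
  rewrite (nr_sqr_orthonormal_sum (fun i => (f (e i))^*)).
  by apply: eq_bigr => i _; rewrite nr_conj.
have sM : nr (v n) ^+ 2 <= M * nr (v n).
  by have := fM (v n); rewrite fv nrR -/s ger0_norm// vs.
rewrite -vs; have [->|t0] := eqVneq (nr (v n)) 0.
  by rewrite expr0n sqr_ge0.
have {}t0 : 0 < nr (v n) by rewrite lt0r t0 nr_ge0.
have tM : nr (v n) <= M by rewrite -(ler_pM2r t0) -expr2.
by rewrite ler_sqr ?nnegrE ?nr_ge0 ?(le_trans (ltW t0) tM).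
Qed.

(** The squares are summable by Bessel's inequality. *)
Lemma orthonormal_weakly_null (f : H -> R[i]) (M : R) :
    (forall a u v, f (a *: u + v) = a * f u + f v) ->
    (forall v, nr (f v) <= M * nr v) ->
  forall d, 0 < d -> exists N, forall n, (N <= n)%N -> nr (f (e n)) <= d.
Proof.
move=> lf fM d d0; pose u n := nr (f (e n)) ^+ 2.
have cu : cvgn (series u).
  apply: nondecreasing_is_cvgn.
    by apply/nondecreasing_seqP => n; rewrite seriesSr lerDl sqr_ge0.
  by exists (M ^+ 2) => _ [n _ <-]; rewrite /series /= big_mkord; exact: bessel.
have := cvg_series_cvg_0 cu; move/cvgrPdist_le => /(_ (d ^+ 2)).
rewrite exprn_gt0// => /(_ isT) [N _ Nu]; exists N => n Nn.
have := Nu n Nn; rewrite /= sub0r normrN ger0_norm ?sqr_ge0//.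
by rewrite ler_sqr// nnegrE ?nr_ge0// ltW.
Qed.

(** Images staying large at arbitrarily late indices would cluster at some [y]; weak nullity of [e]
    forces [ip y y = 0], against the lower bound [d]. *)
Lemma orthonormal_compact_null (K : H -> H) : compact_operator K ->
  forall d : R, 0 < d -> exists N, forall n, (N <= n)%N -> nr (K (e n)) <= d.
Proof.
move=> cK d d0; apply: contrapT => noN.
have /bounded_opP [lK [M M0 KM]] := cK.1.
have /choice[t tP] N : exists n, (N <= n)%N /\ d < nr (K (e n)).
  apply: contrapT => no; apply: noN; exists N => n Nn.
  by rewrite leNgt; apply/negP => lt; apply: no; exists n.
have [n|y yP] := compact_cluster cK (x := fun n => e (t n)).
  by rewrite orthonormal_nr.
have y0 : y = 0.
  apply/nr0_eq0/eqP; rewrite -sqrf_eq0; apply/eqP/complexI; rewrite -(ipxx ip_norm).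
  apply: (@nr_eq0_scaled _ _ _ (nr y + 1)) => [|r r0]; first by rewrite addr_ge0 ?nr_ge0.
  have [||N NK] := orthonormal_weakly_null
    (f := fun v => ip (K v) y) (M := M * nr y) _ _ r0.
  - by move=> a u v; rewrite lK ipDl ipZl.
  - move=> v; apply: le_trans (cauchy_schwarz ip_norm _ _) _.
    by rewrite mulrAC ler_wpM2r ?nr_ge0.
  have [n Nn /ltW nK] := yP r r0 N.
  rewrite {1}(_ : y = K (e (t n)) - (K (e (t n)) - y)); last by zmod.
  rewrite ipBl addrC mulrDl mul1r; apply: le_trans (nrD _ _) _.
  rewrite nrN lerD//; last by apply: NK; exact: leq_trans (tP n).1.
  apply: le_trans (cauchy_schwarz ip_norm _ _) _.
  by rewrite mulrC ler_wpM2l ?nr_ge0.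
have [n _] := yP d d0 0%N; rewrite y0 subr0 => lt.
by have := lt_trans lt (tP n).2; rewrite ltxx.
Qed.

End OrthonormalSequences.

(** * Bump functions with disjoint supports *)

Section Bumps.
Context {R : realType} {X : topologicalType}.
Hypotheses (X_compact : compact [set: X]) (X_hausdorff : hausdorff_space X).

(** Two points of [W] are separated by disjoint open sets [A] and [B]. If [A] meets [W] in an
    infinite set, that part is kept as [W'] and [B] gives [U]; otherwise the finite, hence closed,
    intersection is [U] and its complement in [W] is [W']. *)
Lemma infinite_open_split (W : set X) : open W -> infinite_set W ->
  exists p U W', [/\ open U, U p, U `<=` W &
    [/\ open W', infinite_set W', W' `<=` W & U `&` W' = set0]].
Proof.
move=> oW iW; have [p Wp] := infinite_setN0 iW.
have [q [Wq qp]] : exists q, W q /\ q != p.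
  apply: contrapT => no; apply: iW; apply: sub_finite_set (finite_set1 p) => q Wq.
  by apply/eqP/negPn/negP => qp; apply: no; exists q.
move: (X_hausdorff); rewrite open_hausdorff => /(_ q p qp).
move=> [[A B] /= [/set_mem Aq /set_mem Bp] [oA oB AB]].
have [fA|iA] := pselect (finite_set (A `&` W)).
  have cA : closed (A `&` W).
    have /accessible_finite_set_closed := hausdorff_accessible X_hausdorff.
    exact.
  exists q, (A `&` W), (W `\` (A `&` W)); split=> //; first exact: openI.
  split; [by rewrite setDE; apply: openI => //; exact: closed_openC
    | exact: infinite_setD | by move=> x [] |].
  by rewrite -subset0 => x [AWx [_ /(_ AWx)]].
exists p, (B `&` W), (A `&` W); split=> //; first exact: openI.
split=> //; first exact: openI.
by rewrite -subset0 -(eqP AB) => x [[Bx _] [Ax _]].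
Qed.

(** Urysohn's lemma, compact Hausdorff spaces being normal. *)
Lemma exists_bump (U : set X) p : open U -> U p ->
  exists u : X -> R, [/\ continuous u, forall x, 0 <= u x <= 1, u p = 1 &
    forall x, ~ U x -> u x = 0].
Proof.
move=> oU Up; have nX := compact_normal X_hausdorff X_compact.
have cp : closed [set p] by apply/accessible_closed_set1/hausdorff_accessible.
have dis : ~` U `&` [set p] = set0.
  by rewrite -subset0 => x [nU xp]; apply: nU; rewrite xp.
have /(@uniform_separatorP _ R) [u [cu u01 u0 u1]] :=
  (@normal_separatorP R X).1 nX _ _ (open_closedC oU) cp dis.
exists u; split=> //.
- by move=> x; have := u01 (u x) ltac:(by exists x); rewrite /= in_itv.
- by apply: u1; exists p.
- by move=> x nUx; apply: u0; exists x.
Qed.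

(** Repeated splitting gives decreasing infinite open sets [W n]; the [n]-th bump vanishes outside
    [W n] and on [W n.+1], where all later bumps live. *)
Lemma exists_disjoint_bumps : infinite_set [set: X] ->
  exists (x : nat -> X) (u : nat -> X -> R),
    [/\ forall n, continuous (u n), forall n y, 0 <= u n y <= 1,
        forall n, u n (x n) = 1 &
        forall m n y, m != n -> u m y = 0 \/ u n y = 0].
Proof.
move=> iX.
have step (W : set X) : exists puW : X * (X -> R) * set X, open W -> infinite_set W ->
    [/\ continuous puW.1.2, forall y, 0 <= puW.1.2 y <= 1, puW.1.2 puW.1.1 = 1 &
    [/\ forall y, ~ W y -> puW.1.2 y = 0, open puW.2, infinite_set puW.2,
        puW.2 `<=` W & forall y, puW.2 y -> puW.1.2 y = 0]].
  have [[oW iW]|no] := pselect (open W /\ infinite_set W); last first.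
    have [p _] := infinite_setN0 iX.
    by exists (p, fun=> 0, setT) => oW iW; exfalso; apply: no.
  have [p [U [W' [oU Up UW [oW' iW' W'W UW']]]]] := infinite_open_split oW iW.
  have [u [cu u01 u1 u0]] := exists_bump oU Up.
  exists (p, u, W') => _ _; split=> //; split=> //.
    by move=> y nWy; apply: u0 => /UW.
  move=> y W'y; apply: u0 => Uy; suff : (U `&` W') y by rewrite UW'.
  by split.
have [g gP] := choice step.
pose W := fix W n := if n is m.+1 then (g (W m)).2 else setT.
have [oW iW] : (forall n, open (W n)) /\ (forall n, infinite_set (W n)).
  suff oiW n : open (W n) /\ infinite_set (W n).
    by split=> n; [exact: (oiW n).1 | exact: (oiW n).2].
  elim: n => [|n [oW iW]] /=; first by split=> //; exact: openT.
  by have [_ _ _ [_ ? ? _ _]] := gP (W n) oW iW.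
have gW n := gP (W n) (oW n) (iW n).
have W_sub m n : (m <= n)%N -> W n `<=` W m.
  elim: n => [|n IH]; first by rewrite leqn0 => /eqP ->.
  rewrite leq_eqVlt ltnS => /predU1P [->//|/IH mn].
  by apply: subset_trans mn; have [_ _ _ [_ _ _ ? _]] := gW n.
exists (fun n => (g (W n)).1.1), (fun n => (g (W n)).1.2); split.
- by move=> n; have [] := gW n.
- by move=> n; have [] := gW n.
- by move=> n; have [] := gW n.
have dis m n y : (m < n)%N -> (g (W m)).1.2 y = 0 \/ (g (W n)).1.2 y = 0.
  move=> mn; have [Wy|nWy] := pselect (W n y).
    by left; have [_ _ _ [_ _ _ _]] := gW m; apply; exact: W_sub mn _ Wy.
  by right; have [_ _ _ [+ _ _ _ _]] := gW n; apply.
move=> m n y; rewrite neq_ltn => /orP [/dis //|/dis H].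
by have [] := H y; [right | left].
Qed.

End Bumps.

(** * An F-continuous family of projections without parametrix *)

Section Counterexample.
Context {R : realType} {H : completeNormedModType R[i]}.
Context {ip : {dot H for (@Num.conj R[i])}} (ip_norm : norm_from_dot ip).

(** The free scalar [a] lets one form cover both the projections and the mutually inverse operators
    used to compare them. *)
Lemma rank_one_linear (h w : H) (a : R[i]) :
  linear (fun v => v + a * ip v h *: w).
Proof.
apply: (@linear_add _ _ _ id) => // b u v.
by rewrite ipDl ipZl mulrDr scalerDl scalerA mulrCA.
Qed.

Lemma rank_one_bounded (h w : H) (a : R[i]) M : nr w = 1 -> nr a = 1 -> nr h <= M ->
  bounded_by (1 + M) (fun v => v + a * ip v h *: w).
Proof.
move=> w1 a1 hM; apply: (@bounded_add _ _ _ _ id) => v; first by rewrite mul1r.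
rewrite nrZ w1 mulr1 nrM a1 mul1r mulrC.
by apply: le_trans (cauchy_schwarz ip_norm _ _) _; rewrite ler_wpM2l ?nr_ge0.
Qed.

(* The projection onto the orthogonal complement of [h] along [w]. *)
Lemma fredholm_rank_one (h w : H) : nr w = 1 -> ip w h = 1 ->
  fredholm (fun v => v + -1 * ip v h *: w).
Proof.
move=> w1 wh; set A := fun v => _.
have lA : linear A := rank_one_linear h w (-1).
have AE v : A v = v - ip v h *: w by rewrite /A mulN1r scaleNr.
have Ah v : ip (A v) h = 0 by rewrite AE ipBl ipZl wh mulr1 subrr.
split.
- apply/bounded_opP; split=> //; exists (1 + nr h); first by rewrite addr_ge0 ?nr_ge0.
  by apply: rank_one_bounded; rewrite // nrN -[1]/((1 : R)%:C) nrR normr1.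
- exists 1%N, (fun=> w); apply/seteqP; split=> [v /=|_ [c ->] /=].
    rewrite AE => /eqP; rewrite subr_eq0 => /eqP ->.
    by exists (fun=> ip v h); rewrite big_ord1.
  by rewrite big_ord1 (linZ lA) AE wh scale1r subrr scaler0.
(* A vector orthogonal to [h] is its own image, so only the orthogonality of limits is at stake. *)
- apply: closed_approx => y yapp; exists y => //; rewrite AE.
  suff -> : ip y h = 0 by rewrite scale0r subr0.
  apply: (@nr_eq0_scaled _ _ _ (nr h)) => [|e e0]; first exact: nr_ge0.
  have [z [v _ <-] yz] := yapp e e0.
  have -> : ip y h = ip (y - A v) h by rewrite ipBl Ah subr0.
  apply: le_trans (cauchy_schwarz ip_norm _ _) _.
  by rewrite mulrC ler_wpM2l ?nr_ge0.
- exists 1%N, (fun=> w) => y; exists y, (ip y h *: w); last by rewrite AE subrK.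
  by exists (fun=> ip y h); rewrite big_ord1.
Qed.

Context {X : topologicalType} (X_compact : compact [set: X]).
Context {x : nat -> X} {u : nat -> X -> R}.
Hypotheses (u_cont : forall n, continuous (u n))
  (u01 : forall n y, 0 <= u n y <= 1) (u_x : forall n, u n (x n) = 1)
  (u_disjoint : forall m n y, m != n -> u m y = 0 \/ u n y = 0).
Context {e : nat -> H} (e_on : orthonormal_sequence (ip := ip) e).

(** At most one bump is nonzero at each point; where none is, index 0 serves as default. *)
Lemma bump_selection : exists k : X -> nat, forall n y, n != k y -> u n y = 0.
Proof.
suff /choice[k kP] y : exists k, forall n, n != k -> u n y = 0.
  by exists k => n y; exact: kP.
have [[n un]|no] := pselect (exists n, u n y != 0).
  by exists n => m mn; have [//|u0] := u_disjoint y mn; rewrite u0 eqxx in un.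
by exists 0%N => n _; apply/eqP/negPn/negP => un; apply: no; exists n.
Qed.

Let k := projT1 (cid bump_selection).

Let u0 n y : n != k y -> u n y = 0.
Proof. exact: (projT2 (cid bump_selection)). Qed.

Let kx n : k (x n) = n.
Proof.
apply/eqP/negPn/negP => kn; have /eqP := u_x n.
by rewrite u0 1?eq_sym// oner_eq0.
Qed.

(* [g y] is the sum of the vectors [u n y *: e n.+1], which has at most one
   nonzero term. *)
Let g y : H := (u (k y) y)%:C *: e (k y).+1.

Let e1 n : nr (e n) = 1 := orthonormal_nr ip_norm e_on n.

Let g1 y : nr (g y) <= 1.
Proof.
rewrite nrZR e1 mulr1; have /andP [? ?] := u01 (k y) y.
by rewrite ger0_norm.
Qed.

Let e0g y : ip (e 0%N) (g y) = 0.
Proof. by rewrite ipZr e_on mulr0. Qed.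

Let ip_g v y : ip v (g y) = (u (k y) y)%:C * ip v (e (k y).+1).
Proof. by rewrite ipZr [X in X * _]conjc_real. Qed.

Let partial_sum_near v y0 N (d : R) : 0 < d -> \forall y \near y0,
  nr (\sum_(n < N) (u n y - u n y0)%:C * ip v (e n.+1)) <= d.
Proof.
elim: N d => [|N IH] d d0; first by near=> y; rewrite big_ord0 nr0 ltW.
have d2 : 0 < d / 2 by rewrite divr_gt0.
have c1 : 0 < nr (ip v (e N.+1)) + 1 by rewrite ltr_wpDl ?nr_ge0.
have uN := @u_cont N y0.
have {}uN : \forall y \near y0, `|u N y0 - u N y| <= d / 2 / (nr (ip v (e N.+1)) + 1).
  by move/cvgrPdist_le : uN; apply; rewrite divr_gt0.
near=> y; rewrite big_ord_recr /= [d]splitr.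
apply: le_trans (nrD _ _) _; apply: lerD; first by near: y; exact: IH.
rewrite nrM nrR distrC.
apply: le_trans (_ : d / 2 / (nr (ip v (e N.+1)) + 1) * (nr (ip v (e N.+1)) + 1) <= _).
  apply: ler_pM; rewrite ?nr_ge0 ?lerDl//.
  by near: y; exact: uN.
by rewrite divfK ?gt_eqF.
Unshelve. all: by end_near. Qed.

(* The tail of the series is uniformly small since [e] is weakly null. *)
Let g_weak v y0 (d : R) : 0 < d -> \forall y \near y0, nr (ip v (g y - g y0)) <= d.
Proof.
move=> d0; have d3 : 0 < d / 3 by rewrite divr_gt0.
have [||N Nd] := orthonormal_weakly_null ip_norm e_on (f := ip^~ v) (M := nr v) _ _ d3.
- by move=> a w w'; rewrite ipDl ipZl.
- by move=> w; rewrite mulrC; exact: cauchy_schwarz.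
pose S y := \sum_(n < N) (u n y)%:C * ip v (e n.+1).
have gS y : nr (ip v (g y) - S y) <= d / 3.
  (* For [k y < N] the partial sum contains the only nonzero term; otherwise that term lies in the
     uniformly small tail. *)
  have [kN|Nk] := ltnP (k y) N.
    suff -> : S y = ip v (g y) by rewrite subrr nr0 ltW.
    rewrite /S (bigD1 (Ordinal kN))//= big1 ?addr0 ?ip_g// => i ik.
    by rewrite u0 ?mul0r//; apply: contra ik => /eqP ?; apply/eqP/val_inj.
  rewrite /S big1 ?subr0 => [|i _].
    rewrite ip_g nrM nrR; have /andP [? ?] := u01 (k y) y.
    rewrite ger0_norm// (le_trans (_ : _ <= 1 * nr (ip v (e (k y).+1))))//.
      by rewrite ler_wpM2r ?nr_ge0.
    by rewrite mul1r nr_ipC Nd// leqW.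
  by rewrite u0 ?mul0r// ltn_eqF// (leq_trans (ltn_ord i)).
have nearS := partial_sum_near v y0 N d3.
near=> y.
have -> : ip v (g y - g y0) =
    (ip v (g y) - S y) - (ip v (g y0) - S y0) + (S y - S y0).
  by rewrite ipBr; zmod.
have SS : nr (S y - S y0) <= d / 3.
  rewrite /S -sumrB (_ : \sum_(i < N) _ =
    \sum_(n < N) (u n y - u n y0)%:C * ip v (e n.+1)); first by near: y.
  by apply: eq_bigr => i _; rewrite rmorphB mulrBl.
apply: le_trans (nrD _ _) _; apply: le_trans (lerD (nrB _ _) SS) _.
have := gS y; have := gS y0; lra.
Unshelve. all: by end_near. Qed.

Let h y := e 0%N + g y.

Let e0h y : ip (e 0%N) (h y) = 1.
Proof. by rewrite ipDr e0g addr0 e_on. Qed.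

Let A y : fredholm_op H := FredholmOp (fredholm_rank_one (e1 0) (e0h y)).

Let AE y v : A y v = v - ip v (h y) *: e 0%N.
Proof. by rewrite /= mulN1r scaleNr. Qed.

Let nr1 : nr (1 : R[i]) = 1.
Proof. by rewrite -[1]/((1 : R)%:C) nrR normr1. Qed.

(** The increment [d y] is orthogonal to [e 0], so [T (-1) y] and [T 1 y] are exactly inverse and
    [T (-1) y \o A y0 = A y]; only strong convergence to the identity needs the weak continuity of
    [g]. *)
Let A_F_continuous : F_continuous_maps H X A.
Proof.
move=> y0; pose d y := g y - g y0.
have d2 y : nr (d y) <= 2.
  have := nrB (g y) (g y0); have := g1 y; have := g1 y0; rewrite /d; lra.
have e0d y : ip (e 0%N) (d y) = 0 by rewrite ipBr !e0g subrr.
have sd a : strongly_small (F := nbhs y0) (fun y v => v + a * ip v (d y) *: e 0%N - v).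
  move=> v r r0; have a1 : 0 < nr a + 1 by rewrite ltr_wpDl ?nr_ge0.
  have := g_weak v y0 (divr_gt0 r0 a1); apply: filterS => y dr.
  rewrite addrAC subrr add0r nrZ e1 mulr1 nrM.
  apply: le_trans (_ : (nr a + 1) * (r / (nr a + 1)) <= _).
    by apply: ler_pM; rewrite ?nr_ge0 ?lerDl.
  by rewrite mulrCA divff ?gt_eqF ?mulr1.
have ub a : nr a = 1 -> uniformly_bounded (fun y v => v + a * ip v (d y) *: e 0%N).
  by move=> a1; exists (1 + 2) => [|y]; [exact: addr_ge0 | exact: rank_one_bounded].
have small0 (T : X -> H -> H) : (forall y v, T y v = 0) -> norm_small (F := nbhs y0) T.
  move=> T0 r r0; apply: nearW => y v.
  by rewrite T0 nr0 mulr_ge0 ?nr_ge0 ?(ltW r0).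
have Td a y v : ip (v + a * ip v (d y) *: e 0%N) (d y) = ip v (d y).
  by rewrite ipDl ipZl e0d mulr0 addr0.
have bA : bounded_op (A y0) := fredholm_bounded (A y0).
have hd y v : ip v (h y) = ip v (h y0) + ip v (d y).
  by rewrite /h /d ipBr (ipDr v _ (g y)) (ipDr v _ (g y0)); zmod.
apply: F_continuousP.
  move=> v r r0; have := sd (-1) v r r0; apply: filterS => y.
  suff -> : v + -1 * ip v (d y) *: e 0%N - v = A y v - A y0 v by [].
  by rewrite !AE hd mulN1r scaleNr scalerDl; zmod.
pose T a y v := v + a * ip v (d y) *: e 0%N.
apply: (local_equivalence ip_norm (T := T (-1)) (E := T 1) (G := T 1)).
- by move=> y; exact: rank_one_linear.
- by move=> y; exact: rank_one_linear.
- by move=> y; exact: rank_one_linear.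
- exact: bA.
- by apply: ub; rewrite nrN.
- exact: ub.
- exact: ub.
- exact: sd.
- by apply: small0 => y v; rewrite /T Td mulN1r mul1r scaleNr; zmod.
- by apply: small0 => y v; rewrite /T Td mulN1r mul1r scaleNr; zmod.
- apply: small0 => y v; rewrite /T !AE ipBl ipZl e0d mulr0 subr0 mulN1r (hd y).
  by rewrite scaleNr scalerDl; zmod.
Qed.

(* Since [A y] maps into the orthogonal complement of [h y], a parametrix would
   give [ip (K (x n) (e n.+1)) (h (x n)) = -1], while [K (x n)] is norm-close to
   one compact operator for infinitely many [n]. *)
Let A_no_parametrix : ~ parametrix_maps H X A.
Proof.
move=> [_ [B [_ [K [_ [KE _ cK _]]]]]].
have Ah y v : ip (A y v) (h y) = 0 by rewrite AE ipBl ipZl e0h mulr1 subrr.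
have K_large n : 1 <= 2 * nr (K (x n) (e n.+1)).
  have gx : g (x n) = e n.+1 by rewrite /g kx u_x scale1r.
  have ehx : ip (e n.+1) (h (x n)) = 1.
    by rewrite ipDr gx !e_on eqxx /= add0r.
  have hx2 : nr (h (x n)) <= 2.
    by apply: le_trans (nrD _ _) _; have := g1 (x n); rewrite e1; lra.
  have Kip : ip (K (x n) (e n.+1)) (h (x n)) = - 1.
    by rewrite KE /= ipBl ehx Ah sub0r.
  have := cauchy_schwarz ip_norm (K (x n) (e n.+1)) (h (x n)).
  rewrite Kip nrN nr1 => /le_trans; apply.
  by rewrite mulrC ler_wpM2r ?nr_ge0.
(* At a cluster point [y] of the [x n], two errors of [1 / 8] bound [K (x n) (e n.+1)] by [1 / 4]
   for some large [n], against the lower bound [1 / 2] in [K_large]. *)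
have [|y [_ yc]] := @X_compact (x @ \oo) _ _; first exact: filterT.
have near_y := uniform_continuousP y cK (divr_gt0 ltr01 (ltr0n _ 8) : 0 < 1 / 8%:R).
have [N Nsmall] := orthonormal_compact_null ip_norm e_on (compact_opP (K y))
  (divr_gt0 ltr01 (ltr0n _ 8) : 0 < 1 / 8%:R).
have [|_ [[n Nn <-] /= near_n]] := yc [set x n | n in [set n | (N <= n)%N]] _ _ near_y.
  by exists N => // n Nn; exists n.
have := K_large n; have := near_n (e n.+1); have := Nsmall n.+1 (leqW Nn).
have := nrD (K (x n) (e n.+1) - K y (e n.+1)) (K y (e n.+1)).
by rewrite subrK e1; lra.
Qed.

Lemma F_continuous_not_parametrix :
  exists2 A : X -> fredholm_op H, F_continuous_maps H X A & ~ parametrix_maps H X A.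
Proof. by exists A. Qed.

End Counterexample.

(** On a finite Hausdorff space every map is continuous and every Fredholm operator has a
    parametrix, so the classes coincide; strictness therefore concerns infinite Hausdorff spaces. *)
Theorem mainTheorem3 (R : realType) (H : completeNormedModType R[i])
    (ip : {dot H for (@Num.conj R[i])}) (ip_norm : norm_from_dot ip)
    (H_separable : separable H)
    (H_infinite_dim : ~ fin_dim_subspace [set: H])
    (X : topologicalType) (X_compact : compact [set: X]) :
  parametrix_maps H X `<=` F_continuous_maps H X /\
  (hausdorff_space X -> infinite_set [set: X] ->
   parametrix_maps H X `<` F_continuous_maps H X).
Proof.
have sub := parametrix_maps_F_continuous ip_norm X_compact.
split=> // X_hausdorff X_infinite; split=> // sup.
have [e e_on] := exists_orthonormal_sequence ip_norm H_infinite_dim.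
have [x [u [u_cont u01 u_x u_disjoint]]] :=
  exists_disjoint_bumps (R := R) X_compact X_hausdorff X_infinite.
have [A cA nA] := F_continuous_not_parametrix ip_norm X_compact u_cont u01 u_x
  u_disjoint e_on.
exact: nA (sup A cA).
Qed.
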